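(* Let $k$ be an algebraically closed field of arbitrary characteristic. If $H$ is a finite-dimensional cosemisimple unimodular Hopf algebra over $k$ and $J$ is a twist for $H$, then the twisted Hopf algebra $H^J$ is also cosemisimple and unimodular.
   Context: Let $\Delta,\varepsilon,S$ be the comultiplication, counit and antipode of $H$. A twist for $H$ is an invertible $J\in H\otimes H$ with $(\Delta\otimes\mathrm{id})(J)(J\otimes 1)=(\mathrm{id}\otimes\Delta)(J)(1\otimes J)$, normalized by $(\varepsilon\otimes\mathrm{id})(J)=(\mathrm{id}\otimes\varepsilon)(J)=1$. Write $J=J^{(1)}\otimes J^{(2)}$ (summation understood) and $Q_J=S(J^{(1)})J^{(2)}$, which is invertible. The twisted Hopf algebra $H^J$ has the same algebra structure and counit as $H$, comultiplication $\Delta^J(h)=J^{-1}\Delta(h)J$ and antipode $S^J(h)=Q_J^{-1}S(h)Q_J$. $H$ is unimodular if the left and right integrals in $H$ coincide. *)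

(* Defs.v *)
From HB Require Import structures.
From mathcomp Require Import all_boot all_algebra all_field.

Set Implicit Arguments.
Unset Strict Implicit.
Unset Printing Implicit Defensive.

Import GRing.Theory.
Local Open Scope ring_scope.

Reserved Notation "u ⊗ v" (at level 39, left associativity).

(* The entry (i, j) of an element of U ⊗ V is its coefficient on              *)
(* e_i ⊗ f_j, for the bases e = vbasis {:U} and f = vbasis {:V}. This alias   *)
(* for a matrix type hides the matrix product, which is not the product       *)
(* of the tensor product of two algebras.                                     *)
Definition tensor (k : fieldType) (U V : vectType k) : Type :=
  'M[k]_(\dim {:U}, \dim {:V}).

Section TensorSpace.
Variables (k : fieldType) (U V : vectType k).

HB.instance Definition _ := Vector.on (tensor U V).

Definition tens (u : U) (v : V) : tensor U V :=
  \matrix_(i, j) (coord (vbasis {:U}) i u * coord (vbasis {:V}) j v).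

(* For f bilinear, tlift f is the linear map with u ⊗ v |-> f u v; see tliftE. *)
Definition tlift (W : lmodType k) (f : U -> V -> W) (t : tensor U V) : W :=
  \sum_i \sum_j (t : 'M_(_, _)) i j *: f (vbasis {:U})`_i (vbasis {:V})`_j.

End TensorSpace.

Notation "u ⊗ v" := (tens u v) : ring_scope.

Section Linear.
Variable k : fieldType.
Implicit Types U V W X : lmodType k.

Definition lin U V (f : U -> V) := linear f.

Lemma lin_id U : lin (fun x : U => x). Proof. by []. Qed.

Lemma lin_comp U V W (L : {linear V -> W}) (g : U -> V) :
  lin g -> lin (fun x => L (g x)).
Proof. by move=> lg a x y; rewrite lg linearP. Qed.

Lemma lin_mull U (A : algType k) (c : A) (g : U -> A) :
  lin g -> lin (fun x => c * g x).
Proof. by move=> lg a x y; rewrite lg mulrDr scalerAr. Qed.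

Lemma lin_mulr U (A : algType k) (c : A) (g : U -> A) :
  lin g -> lin (fun x => g x * c).
Proof. by move=> lg a x y; rewrite lg mulrDl scalerAl. Qed.

Lemma lin_scalel U V (c : V) (g : U -> k^o) : lin g -> lin (fun x => g x *: c).
Proof. by move=> lg a x y; rewrite lg scalerDl scalerA. Qed.

Lemma lin_scaler U V (c : k) (g : U -> V) : lin g -> lin (fun x => c *: g x).
Proof. by move=> lg a x y; rewrite lg scalerDr !scalerA mulrC. Qed.

Lemma lin_scale U V (f : U -> V) c u : lin f -> f (c *: u) = c *: f u.
Proof.
move=> lf; pose L : {linear U -> V} := HB.pack f (GRing.isLinear.Build _ _ _ _ f lf).
by rewrite -[f]/(L : _ -> _) linearZ.
Qed.

Lemma lin_sum U V (f : U -> V) (I : finType) (c : I -> k) (F : I -> U) :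
  lin f -> f (\sum_i c i *: F i) = \sum_i c i *: f (F i).
Proof.
move=> lf; pose L : {linear U -> V} := HB.pack f (GRing.isLinear.Build _ _ _ _ f lf).
rewrite -[f]/(L : _ -> _) linear_sum; apply: eq_bigr => i _; exact: linearZ.
Qed.

End Linear.

Section TensorTheory.
Variables (k : fieldType) (U V : vectType k).

Lemma tens_linl (X : lmodType k) (f : X -> U) (v : V) :
  lin f -> lin (fun x => f x ⊗ v).
Proof.
move=> lf a x y; rewrite lf; apply/matrixP=> i j.
by rewrite !mxE linearP /= mulrDl mulrA.
Qed.

Lemma tens_linr (X : lmodType k) (f : X -> V) (u : U) :
  lin f -> lin (fun x => u ⊗ f x).
Proof.
move=> lf a x y; rewrite lf; apply/matrixP=> i j.
by rewrite !mxE linearP /= mulrDr mulrCA.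
Qed.

Lemma coord_vbasis_delta (W : vectType k) (i j : 'I_(\dim {:W})) :
  coord (vbasis {:W}) i (vbasis {:W})`_j = (i == j)%:R.
Proof. by rewrite coord_free ?(basis_free (vbasisP _)) // eq_sym. Qed.

Lemma tens_expand (t : tensor U V) :
  t = \sum_i \sum_j (t : 'M_(_, _)) i j *: ((vbasis {:U})`_i ⊗ (vbasis {:V})`_j).
Proof.
apply/matrixP=> p q; rewrite summxE (bigD1 p) //= summxE (bigD1 q) //= !mxE.
rewrite !coord_vbasis_delta !eqxx !mulr1 big1 ?addr0 => [|j /negbTE nj].
  rewrite big1 ?addr0 // => i /negbTE ni; rewrite summxE big1 // => j _.
  by rewrite !mxE !coord_vbasis_delta [p == _]eq_sym ni mul0r mulr0.
by rewrite !mxE !coord_vbasis_delta [q == _]eq_sym nj !mulr0.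
Qed.

Section Lift.
Variable W : lmodType k.
Implicit Types f g : U -> V -> W.

Fact tlift_is_linear f : linear (tlift f).
Proof.
move=> a s t; rewrite /tlift scaler_sumr -big_split; apply: eq_bigr => i _.
rewrite scaler_sumr -big_split; apply: eq_bigr => j _ /=.
by rewrite !mxE scalerDl scalerA.
Qed.
HB.instance Definition _ f :=
  GRing.isLinear.Build k (tensor U V) W _ (tlift f) (tlift_is_linear f).

Lemma tliftE f u v : (forall b, lin (f^~ b)) -> (forall a, lin (f a)) ->
  tlift f (u ⊗ v) = f u v.
Proof.
move=> l1 l2; rewrite {2}(coord_vbasis (memvf u)) (lin_sum _ _ (l1 _)).
apply: eq_bigr => i _; rewrite {2}(coord_vbasis (memvf v)) (lin_sum _ _ (l2 _)).
by rewrite scaler_sumr; apply: eq_bigr => j _; rewrite mxE scalerA.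
Qed.

Lemma eq_tlift f g t : (forall a b, f a b = g a b) -> tlift f t = tlift g t.
Proof.
by move=> e; apply: eq_bigr => i _; apply: eq_bigr => j _; rewrite e.
Qed.

Lemma lin_tlift (X : lmodType k) (F : X -> U -> V -> W) (t : tensor U V) :
  (forall a b, lin (fun x => F x a b)) -> lin (fun x => tlift (F x) t).
Proof.
move=> lF a x y; rewrite /tlift scaler_sumr -big_split; apply: eq_bigr => i _.
rewrite scaler_sumr -big_split; apply: eq_bigr => j _ /=.
by rewrite (lF _ _ a) scalerDr !scalerA mulrC.
Qed.

Lemma tens_ext (f g : tensor U V -> W) : lin f -> lin g ->
  (forall u v, f (u ⊗ v) = g (u ⊗ v)) -> f =1 g.
Proof.
move=> lf lg e t; rewrite [t]tens_expand.
pose F : {linear _ -> _} := HB.pack f (GRing.isLinear.Build _ _ _ _ f lf).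
pose G : {linear _ -> _} := HB.pack g (GRing.isLinear.Build _ _ _ _ g lg).
rewrite -[f]/(F : _ -> _) -[g]/(G : _ -> _) !linear_sum; apply: eq_bigr => i _.
by rewrite !linear_sum; apply: eq_bigr => j _; rewrite !linearZ /= e.
Qed.

End Lift.

Lemma comp_tlift (W X : lmodType k) (L : W -> X) f (t : tensor U V) :
  lin L -> L (tlift f t) = tlift (fun a b => L (f a b)) t.
Proof.
move=> lL; pose F : {linear _ -> _} := HB.pack L (GRing.isLinear.Build _ _ _ _ L lL).
rewrite -[L]/(F : _ -> _) linear_sum; apply: eq_bigr => i _.
by rewrite linear_sum; apply: eq_bigr => j _; rewrite linearZ.
Qed.

End TensorTheory.

Ltac lin := solve [repeat (intros; cbv beta; first
  [ exact: lin_id | assumption | apply: lin_tlift | apply: lin_mull | apply: lin_mulr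
  | apply: tens_linl | apply: tens_linr | apply: lin_scalel | apply: lin_scaler
  | apply: lin_comp
  | match goal with H : _ |- lin _ => solve [apply: H] end ])].

Section TensorAlgebra.
Variables (k : fieldType) (A B : falgType k).

Definition tens_mul (s t : tensor A B) : tensor A B :=
  tlift (fun a b => tlift (fun a' b' => (a * a') ⊗ (b * b')) t) s.

Lemma tens_mulE a b a' b' :
  tens_mul (a ⊗ b) (a' ⊗ b') = (a * a') ⊗ (b * b').
Proof. by rewrite /tens_mul !tliftE //; lin. Qed.

Lemma lin_tens_mull (X : lmodType k) (f : X -> tensor A B) t :
  lin f -> lin (fun x => tens_mul (f x) t).
Proof. by move=> lf a x y; rewrite lf /tens_mul linearP. Qed.

Lemma lin_tens_mulr (X : lmodType k) (f : X -> tensor A B) s :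
  lin f -> lin (fun x => tens_mul s (f x)).
Proof. by rewrite /tens_mul => lf; lin. Qed.

Ltac lin' := solve [repeat (intros; cbv beta;
  first [ lin | apply: lin_tens_mull | apply: lin_tens_mulr ])].

Fact tens_mulA : associative tens_mul.
Proof.
move=> r s t; move: r; apply: tens_ext; [lin'|lin'|move=> a b].
move: s; apply: tens_ext; [lin'|lin'|move=> a' b'].
move: t; apply: tens_ext; [lin'|lin'|move=> a'' b''].
by rewrite !tens_mulE !mulrA.
Qed.

Fact tens_mul1 : left_id (1 ⊗ 1) tens_mul.
Proof.
by apply: tens_ext; [lin'|lin'|move=> a b]; rewrite tens_mulE !mul1r.
Qed.

Fact tens_mulr1 : right_id (1 ⊗ 1) tens_mul.
Proof.
by apply: tens_ext; [lin'|lin'|move=> a b]; rewrite tens_mulE !mulr1.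
Qed.

Fact tens_mulDl : left_distributive tens_mul +%R.
Proof. by move=> r s t; rewrite /tens_mul linearD. Qed.

Fact tens_mulDr : right_distributive tens_mul +%R.
Proof.
by move=> r s t; have := lin_tens_mulr r (@lin_id _ _) 1 s t; rewrite !scale1r.
Qed.

Fact tens1_neq0 : 1 ⊗ 1 != 0 :> tensor A B.
Proof.
have nz (C : falgType k) : exists i, coord (vbasis {:C}) i (1 : C) != 0.
  apply/existsP; apply: contra_neqT (oner_neq0 C); rewrite negb_exists.
  move/forallP=> c0; rewrite [LHS](coord_vbasis (memvf _)) big1 // => i _.
  by have /negPn/eqP-> := c0 i; rewrite scale0r.
have [[i ni] [j nj]] := (nz A, nz B).
apply/eqP=> /matrixP/(_ i j)/eqP; rewrite !mxE mulf_eq0.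
by rewrite (negbTE ni) (negbTE nj).
Qed.

HB.instance Definition _ := GRing.Zmodule_isNzRing.Build (tensor A B)
  tens_mulA tens_mul1 tens_mulr1 tens_mulDl tens_mulDr tens1_neq0.

Fact tens_scaleAl (c : k) (s t : tensor A B) : c *: (s * t) = (c *: s) * t.
Proof. by rewrite /GRing.mul /= /tens_mul linearZ. Qed.
HB.instance Definition _ :=
  GRing.Lmodule_isLalgebra.Build k (tensor A B) tens_scaleAl.

Fact tens_scaleAr (c : k) (s t : tensor A B) : c *: (s * t) = s * (c *: t).
Proof.
have := lin_tens_mulr s (@lin_id _ _) c t 0; rewrite !addr0 /GRing.mul /=.
have -> : tens_mul s 0 = 0 by exact: (@mulr0 (tensor A B)).
by rewrite addr0.
Qed.
HB.instance Definition _ :=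
  GRing.Lalgebra_isAlgebra.Build k (tensor A B) tens_scaleAr.
HB.instance Definition _ := Algebra_isFalgebra.Build k (tensor A B).

Lemma tensM a b a' b' :
  (a ⊗ b) * (a' ⊗ b') = (a * a') ⊗ (b * b') :> tensor A B.
Proof. exact: tens_mulE. Qed.

Lemma tens1 : 1 ⊗ 1 = 1 :> tensor A B.
Proof. by []. Qed.

(* A linear map out of A ⊗ B that is multiplicative on pure tensors is        *)
(* multiplicative.                                                            *)
Lemma tens_multiplicative (C : algType k) (f : tensor A B -> C) : lin f ->
  (forall a b a' b', f ((a ⊗ b) * (a' ⊗ b')) = f (a ⊗ b) * f (a' ⊗ b')) ->
  {morph f : s t / s * t}.
Proof.
move=> lf fM s t.
have lc (X : lmodType k) (g : X -> tensor A B) : lin g -> lin (fun x => f (g x)).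
  by move=> lg a x y; rewrite lg lf.
move: s; apply: tens_ext => [| |a b]; [by apply: lc; lin|by apply/lin_mulr|].
move: t; apply: tens_ext => [| |a' b']; [by apply: lc; lin|by apply/lin_mull|].
exact: fM.
Qed.

End TensorAlgebra.

Section TensorMaps.
Variable k : fieldType.

Definition tmap (U V U' V' : vectType k) (f : U -> U') (g : V -> V') :
    tensor U V -> tensor U' V' :=
  tlift (fun u v => f u ⊗ g v).

Definition tassoc (U V W : vectType k) :
    tensor (tensor U V) W -> tensor U (tensor V W) :=
  tlift (fun t w => tlift (fun u v => u ⊗ (v ⊗ w)) t).

HB.instance Definition _ (U V U' V' : vectType k) (f : U -> U') (g : V -> V') :=
  GRing.Linear.on (tmap f g).
HB.instance Definition _ (U V W : vectType k) :=
  GRing.Linear.on (@tassoc U V W).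

Lemma tmapE (U V U' V' : vectType k) (f : {linear U -> U'})
  (g : {linear V -> V'}) u v : tmap f g (u ⊗ v) = f u ⊗ g v.
Proof. by rewrite /tmap tliftE //; lin. Qed.

Lemma tassocE (U V W : vectType k) (u : U) (v : V) (w : W) :
  tassoc ((u ⊗ v) ⊗ w) = u ⊗ (v ⊗ w).
Proof. by rewrite /tassoc !tliftE //; lin. Qed.

Section Morphisms.
Variables A B C A' B' : falgType k.

Section Tmap.
Variables (f : {lrmorphism A -> A'}) (g : {lrmorphism B -> B'}).

Fact tmap_monoid_morphism : monoid_morphism (tmap f g).
Proof.
split; first by rewrite -tens1 tmapE !rmorph1.
apply: tens_multiplicative => [|a b a' b']; first by lin.
by rewrite tensM !tmapE !rmorphM -tensM.
Qed.
HB.instance Definition _ :=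
  GRing.isMonoidMorphism.Build (tensor A B) (tensor A' B') (tmap f g)
    tmap_monoid_morphism.
End Tmap.

Fact tassoc_monoid_morphism : monoid_morphism (@tassoc A B C).
Proof.
split; first by rewrite -!tens1 tassocE.
apply: tens_multiplicative => [|s c s' c']; first by lin.
rewrite tensM; move: s; apply: tens_ext; [by lin|by lin|move=> a b].
move: s'; apply: tens_ext; [by lin|by lin|move=> a' b'].
by rewrite tensM !tassocE !tensM.
Qed.
HB.instance Definition _ :=
  GRing.isMonoidMorphism.Build (tensor (tensor A B) C) (tensor A (tensor B C))
    (@tassoc A B C) tassoc_monoid_morphism.

End Morphisms.
End TensorMaps.

(* The iterated tensor products (H ⊗ H) ⊗ H and H ⊗ (H ⊗ H) are distinct      *)
(* types, identified by the algebra isomorphism tassoc.                       *)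
Record hopfAlgebra (k : fieldType) (H : falgType k) := HopfAlgebra {
  comul : {lrmorphism H -> tensor H H};
  counit : {lrmorphism H -> k^o};
  antipode : {linear H -> H};
  comulA : forall h,
    tassoc (tmap comul idfun (comul h)) = tmap idfun comul (comul h);
  counitl : forall h, tlift (fun a b => counit a *: b) (comul h) = h;
  counitr : forall h, tlift (fun a b => counit b *: a) (comul h) = h;
  antipodel : forall h,
    tlift (fun a b => antipode a * b) (comul h) = counit h *: 1;
  antipoder : forall h,
    tlift (fun a b => a * antipode b) (comul h) = counit h *: 1
}.

Section Notions.
Variables (k : fieldType) (H : falgType k) (hH : hopfAlgebra H).
Local Notation Δ := (comul hH).
Local Notation ε := (counit hH).
Local Notation S := (antipode hH).

Definition left_integral (t : H) : Prop := forall h, h * t = ε h *: t.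

Definition right_integral (t : H) : Prop := forall h, t * h = ε h *: t.

Definition unimodular : Prop := forall t, left_integral t <-> right_integral t.

Definition tensv (U V : vectType k) (C : {vspace U}) (D : {vspace V}) :
    {vspace tensor U V} :=
  <<[seq c ⊗ d | c <- vbasis C, d <- vbasis D]>>%VS.

Definition subcoalgebra (C : {vspace H}) : Prop :=
  forall c, c \in C -> Δ c \in tensv C C.

Definition simple_subcoalgebra (C : {vspace H}) : Prop :=
  [/\ subcoalgebra C, C != 0%VS &
      forall D, subcoalgebra D -> (D <= C)%VS -> D = 0%VS \/ D = C].

Definition cosemisimple : Prop :=
  exists n (C : 'I_n -> {vspace H}),
    [/\ forall i, simple_subcoalgebra (C i), directv (\sum_i C i) &
        (\sum_i C i)%VS = {:H}%VS].

Record is_twist (J : tensor H H) : Prop := IsTwist {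
  twist_unit : J \is a GRing.unit;
  twist_cocycle :
    tassoc (tmap Δ idfun J * (J ⊗ 1)) = tmap idfun Δ J * (1 ⊗ J);
  twist_counitl : tlift (fun a b => ε a *: b) J = 1;
  twist_counitr : tlift (fun a b => ε b *: a) J = 1
}.

Definition twistQ (J : tensor H H) : H := tlift (fun a b => S a * b) J.

Section AntipodeTheory.

Lemma coassoc3 (W : lmodType k) (F : H -> H -> H -> W) (x : H) :
  (forall b c, lin (fun a => F a b c)) -> (forall a c, lin (fun b => F a b c)) ->
  (forall a b, lin (fun c => F a b c)) ->
  tlift (fun a b => tlift (fun a1 a2 => F a1 a2 b) (Δ a)) (Δ x) =
  tlift (fun a b => tlift (fun b1 b2 => F a b1 b2) (Δ b)) (Δ x).
Proof.
move=> l1 l2 l3.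
pose G : {linear tensor H (tensor H H) -> W} := tlift (fun a t => tlift (F a) t).
have GE a t : G (a ⊗ t) = tlift (F a) t by rewrite /= tliftE //; lin.
have GE3 a b c : G (a ⊗ (b ⊗ c)) = F a b c by rewrite GE tliftE //; lin.
have /(congr1 G) := comulA hH x.
have -> : G (tassoc (tmap Δ idfun (Δ x))) =
    tlift (fun a b => tlift (fun a1 a2 => F a1 a2 b) (Δ a)) (Δ x).
  move: (Δ x); apply: tens_ext => [||u v]; [lin|lin|rewrite tmapE tliftE /=; try lin].
  move: (Δ u); apply: tens_ext => [||a b]; [lin|lin|].
  by rewrite tassocE GE3 tliftE //; lin.
move->; move: (Δ x); apply: tens_ext => [||u v]; [lin|lin|].
by rewrite tmapE GE tliftE //; lin.
Qed.

Lemma tlift_exchange (U V X Y : vectType k) (W : lmodType k)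
    (F : U -> V -> X -> Y -> W) s t :
  tlift (fun a b => tlift (F a b) t) s =
  tlift (fun c d => tlift (fun a b => F a b c d) s) t.
Proof.
rewrite /tlift; under eq_bigr do under eq_bigr do rewrite scaler_sumr.
under [RHS]eq_bigr do under eq_bigr do rewrite scaler_sumr.
under eq_bigr do rewrite exchange_big /=.
rewrite exchange_big; apply: eq_bigr => p _ /=.
under eq_bigr do under eq_bigr do rewrite scaler_sumr.
under [RHS]eq_bigr do under eq_bigr do rewrite scaler_sumr.
under eq_bigr do rewrite exchange_big /=.
rewrite exchange_big /=; apply: eq_bigr => q _.
apply: eq_bigr => i _; apply: eq_bigr => j _.
by rewrite !scalerA mulrC.
Qed.

(* Convolution of bilinear maps on H, that is, of maps H ⊗ H -> H.            *)
Definition conv2 (f g : H -> H -> H) (x y : H) : H :=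
  tlift (fun x1 x2 => tlift (fun y1 y2 => f x1 y1 * g x2 y2) (Δ y)) (Δ x).

Lemma conv2A (f g h : H -> H -> H) x y :
  (forall b, lin (f^~ b)) -> (forall a, lin (f a)) ->
  (forall b, lin (g^~ b)) -> (forall a, lin (g a)) ->
  (forall b, lin (h^~ b)) -> (forall a, lin (h a)) ->
  conv2 (conv2 f g) h x y = conv2 f (conv2 g h) x y.
Proof.
move=> f1 f2 g1 g2 h1 h2; rewrite /conv2.
transitivity (tlift (fun a b => tlift (fun a1 a2 =>
   tlift (fun c d => tlift (fun c1 c2 => f a1 c1 * g a2 c2 * h b d) (Δ c)) (Δ y))
     (Δ a)) (Δ x)).
  apply: eq_tlift => a b; rewrite [RHS]tlift_exchange; apply: eq_tlift => c d.
  rewrite (@comp_tlift _ _ _ _ _ (fun z => z * h b d)); last by lin.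
  apply: eq_tlift => a1 a2; rewrite (@comp_tlift _ _ _ _ _ (fun z => z * h b d)) //.
  by lin.
rewrite (coassoc3 (F := fun a1 a2 b => tlift (fun c d => tlift (fun c1 c2 =>
  f a1 c1 * g a2 c2 * h b d) (Δ c)) (Δ y))); try lin.
apply: eq_tlift => a b.
transitivity (tlift (fun b1 b2 => tlift (fun c d => tlift (fun d1 d2 =>
   f a c * g b1 d1 * h b2 d2) (Δ d)) (Δ y)) (Δ b)).
  apply: eq_tlift => b1 b2.
  by rewrite (coassoc3 (F := fun c1 c2 d => f a c1 * g b1 c2 * h b2 d)); try lin.
rewrite tlift_exchange; apply: eq_tlift => c d.
rewrite (@comp_tlift _ _ _ _ _ (fun z => f a c * z)); last by lin.
apply: eq_tlift => b1 b2.
rewrite (@comp_tlift _ _ _ _ _ (fun z => f a c * z)); last by lin.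
by apply: eq_tlift => d1 d2; rewrite mulrA.
Qed.

Lemma antipode1 : S 1 = 1.
Proof.
have := antipodel hH 1; rewrite !rmorph1 -tens1 tliftE; try lin.
by rewrite mulr1 => ->; rewrite scale1r.
Qed.

Lemma antipodeM (x y : H) : S (x * y) = S y * S x.
Proof.
pose nu a b := S (a * b); pose m (a b : H) := a * b; pose mu a b := S b * S a.
pose eta a b : H := ε a *: (ε b *: 1).
have mulE s t : tlift (fun x1 x2 => tlift (fun y1 y2 =>
    S (x1 * y1) * (x2 * y2)) t) s = tlift (fun a b => S a * b) (s * t).
  move: s; apply: tens_ext => [||a1 a2]; [lin|lin|rewrite tliftE; try lin].
  move: t; apply: tens_ext => [||b1 b2]; [lin|lin|rewrite tliftE; try lin].
  by rewrite tensM tliftE //; lin.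
have nuE a b : conv2 nu m a b = eta a b.
  rewrite /eta scalerA -[ε a * ε b]/((ε a : k^o) * ε b) -rmorphM -antipodel.
  by rewrite rmorphM; apply: mulE.
have muE a b : conv2 m mu a b = eta a b.
  rewrite /conv2 /m /mu /eta.
  transitivity (tlift (fun a1 a2 : H => a1 * (ε b *: 1) * S a2) (Δ a)).
    apply: eq_tlift => a1 a2; rewrite -antipoder.
    rewrite (@comp_tlift _ _ _ _ _ (fun z => a1 * z * S a2)); last by lin.
    by apply: eq_tlift => b1 b2; rewrite !mulrA.
  transitivity (ε b *: tlift (fun a1 a2 : H => a1 * S a2) (Δ a)).
    apply: etrans; last by
      apply: esym; apply: (@comp_tlift _ _ _ _ _ (fun z : H => ε b *: z)); lin.
    by apply: eq_tlift => a1 a2; rewrite -scalerAr mulr1 scalerAl.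
  by rewrite antipoder !scalerA mulrC.
have etar f a b : (forall b, lin (f^~ b)) -> (forall a, lin (f a)) ->
    conv2 f eta a b = f a b.
  move=> f1 f2; rewrite /conv2 /eta.
  transitivity (tlift (fun a1 a2 : H => ε a2 *: f a1 b) (Δ a)).
    apply: eq_tlift => a1 a2; rewrite -{2}(counitr hH b).
    rewrite (@comp_tlift _ _ _ _ _ (fun z => ε a2 *: f a1 z)); last by lin.
    apply: eq_tlift => b1 b2; rewrite -!scalerAr mulr1.
    by rewrite (lin_scale _ _ (f2 _)).
  rewrite -{2}(counitr hH a) (@comp_tlift _ _ _ _ _ (f^~ b)) //.
  by apply: eq_tlift => a1 a2; rewrite -(lin_scale _ _ (f1 _)).
have etal f a b : (forall b, lin (f^~ b)) -> (forall a, lin (f a)) ->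
    conv2 eta f a b = f a b.
  move=> f1 f2; rewrite /conv2 /eta.
  transitivity (tlift (fun a1 a2 : H => ε a1 *: f a2 b) (Δ a)).
    apply: eq_tlift => a1 a2; rewrite -{2}(counitl hH b).
    rewrite (@comp_tlift _ _ _ _ _ (fun z => ε a1 *: f a2 z)); last by lin.
    apply: eq_tlift => b1 b2; rewrite -!scalerAl mul1r.
    by rewrite (lin_scale _ _ (f2 _)).
  rewrite -{2}(counitl hH a) (@comp_tlift _ _ _ _ _ (f^~ b)) //.
  by apply: eq_tlift => a1 a2; rewrite -(lin_scale _ _ (f1 _)).
rewrite -[LHS]/(nu x y) -(etar nu); try by rewrite /nu => *; lin.
transitivity (conv2 nu (conv2 m mu) x y).
  by apply: eq_tlift => a1 a2; apply: eq_tlift => b1 b2; rewrite muE.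
rewrite -conv2A; try by rewrite /nu /m /mu => *; lin.
transitivity (conv2 eta mu x y).
  by apply: eq_tlift => a1 a2; apply: eq_tlift => b1 b2; rewrite nuE.
by rewrite etal // /mu => *; lin.
Qed.

End AntipodeTheory.

End Notions.

Lemma falg_mulr1_unit (k : fieldType) (A : falgType k) (x y : A) :
  x * y = 1 -> y * x = 1.
Proof.
move=> xy1; have ker0 : lker (amull y) == 0%VS.
  apply/lker0P=> u v; rewrite !lfunE /= => /(congr1 ( *%R x)).
  by rewrite !mulrA xy1 !mul1r.
have := lker0_lfunVK ker0 1; rewrite lfunE /= => yz1.
by rewrite -[x]mulr1 -{1}yz1 [x * _]mulrA xy1 mul1r.
Qed.

Section Twisting.
Variables (k : fieldType) (H : falgType k) (hH : hopfAlgebra H) (J : tensor H H)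
  (hJ : is_twist hH J).
Local Notation Δ := (comul hH).
Local Notation ε := (counit hH).
Local Notation S := (antipode hH).
Local Notation Q := (twistQ hH J).

Definition twist_comul of is_twist hH J := fun h => J^-1 * Δ h * J.

Definition twist_antipode (h : H) : H := Q^-1 * S h * Q.

Fact twist_comul_linear : linear (twist_comul hJ).
Proof. by change (lin (twist_comul hJ)); rewrite /twist_comul; lin. Qed.
HB.instance Definition _ :=
  GRing.isLinear.Build k H (tensor H H) _ (twist_comul hJ) twist_comul_linear.

Fact twist_comul_monoid_morphism : monoid_morphism (twist_comul hJ).
Proof.
have uJ := twist_unit hJ.
split=> [|x y]; first by rewrite /twist_comul rmorph1 mulr1 mulVr.
by rewrite /twist_comul rmorphM !mulrA mulrK.
Qed.
HB.instance Definition _ :=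
  GRing.isMonoidMorphism.Build H (tensor H H) (twist_comul hJ)
    twist_comul_monoid_morphism.

Fact twist_antipode_linear : linear twist_antipode.
Proof. by change (lin twist_antipode); rewrite /twist_antipode; lin. Qed.
HB.instance Definition _ :=
  GRing.isLinear.Build k H H _ twist_antipode twist_antipode_linear.

Lemma tmap_twistl t : tmap (twist_comul hJ) idfun t =
  (J^-1 ⊗ (1 : H)) * tmap Δ idfun t * (J ⊗ (1 : H)).
Proof.
move: t; apply: tens_ext => [||a b]; [lin|lin|].
by rewrite !tmapE !tensM /= mul1r mulr1.
Qed.

Lemma tmap_twistr t : tmap idfun (twist_comul hJ) t =
  ((1 : H) ⊗ J^-1) * tmap idfun Δ t * ((1 : H) ⊗ J).
Proof.
move: t; apply: tens_ext => [||a b]; [lin|lin|].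
by rewrite !tmapE !tensM /= mul1r mulr1.
Qed.

Fact twist_comulA h :
  tassoc (tmap (twist_comul hJ) idfun (twist_comul hJ h)) =
  tmap idfun (twist_comul hJ) (twist_comul hJ h).
Proof.
have uJ := twist_unit hJ.
have VJ1 : (J^-1 ⊗ (1 : H)) * (J ⊗ (1 : H)) = 1 :> tensor (tensor H H) H.
  by rewrite tensM mulVr // mul1r tens1.
have V1J : ((1 : H) ⊗ J^-1) * ((1 : H) ⊗ J) = 1 :> tensor H (tensor H H).
  by rewrite tensM mulVr // mul1r tens1.
set X : tensor H (tensor H H) := tassoc (tmap Δ idfun J * (J ⊗ (1 : H))).
set Y1 := tassoc ((J^-1 ⊗ (1 : H)) * tmap Δ idfun J^-1).
set Y2 := ((1 : H) ⊗ J^-1) * tmap idfun Δ J^-1.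
have XE : X = tmap idfun Δ J * ((1 : H) ⊗ J) := twist_cocycle hJ.
have Y1X : Y1 * X = 1.
  rewrite /Y1 /X -rmorphM /= mulrA -[_ * _ * tmap _ _ J]mulrA -rmorphM /= mulVr //.
  by rewrite rmorph1 mulr1 VJ1 rmorph1.
have Y2X : Y2 * X = 1.
  rewrite /Y2 XE mulrA -[_ * _ * tmap _ _ J]mulrA -rmorphM /= mulVr //.
  by rewrite rmorph1 mulr1 V1J.
have Y12 : Y1 = Y2.
  by rewrite -[Y1]mulr1 -(falg_mulr1_unit Y2X) mulrA Y1X mul1r.
have -> : tassoc (tmap (twist_comul hJ) idfun (twist_comul hJ h)) =
    Y1 * tassoc (tmap Δ idfun (Δ h)) * X.
  by rewrite -!rmorphM tmap_twistl /twist_comul !rmorphM /= !mulrA.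
have -> : tmap idfun (twist_comul hJ) (twist_comul hJ h) =
    Y2 * tmap idfun Δ (Δ h) * X.
  by rewrite XE tmap_twistr /twist_comul !rmorphM /= !mulrA.
by rewrite Y12 comulA.
Qed.

(* The maps ε ⊗ id and id ⊗ ε, as algebra morphisms to H.                     *)
Let el (t : tensor H H) : H := tlift (fun a b => ε a *: b) t.
Let er (t : tensor H H) : H := tlift (fun a b => ε b *: a) t.

Let elM : {morph el : s t / s * t}.
Proof.
apply: tens_multiplicative => [|a b a' b']; rewrite /el; first by lin.
rewrite tensM !tliftE; try lin.
by rewrite rmorphM -scalerAl -scalerAr scalerA.
Qed.

Let erM : {morph er : s t / s * t}.
Proof.
apply: tens_multiplicative => [|a b a' b']; rewrite /er; first by lin.
rewrite tensM !tliftE; try lin.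
by rewrite rmorphM -scalerAl -scalerAr scalerA.
Qed.

Let el1 : el 1 = 1.
Proof. by rewrite /el -tens1 tliftE ?rmorph1 ?scale1r //; lin. Qed.

Let er1 : er 1 = 1.
Proof. by rewrite /er -tens1 tliftE ?rmorph1 ?scale1r //; lin. Qed.

Let elJ : el J = 1. Proof. exact: twist_counitl hJ. Qed.
Let erJ : er J = 1. Proof. exact: twist_counitr hJ. Qed.

Let elV : el J^-1 = 1.
Proof. by rewrite -[LHS]mulr1 -elJ -elM mulVr ?el1 ?(twist_unit hJ). Qed.

Let erV : er J^-1 = 1.
Proof. by rewrite -[LHS]mulr1 -erJ -erM mulVr ?er1 ?(twist_unit hJ). Qed.

Fact twist_comul_counitl h :
  tlift (fun a b => ε a *: b) (twist_comul hJ h) = h.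
Proof.
rewrite -[LHS]/(el _) /twist_comul !elM elV elJ mul1r mulr1.
exact: counitl.
Qed.

Fact twist_comul_counitr h :
  tlift (fun a b => ε b *: a) (twist_comul hJ h) = h.
Proof.
rewrite -[LHS]/(er _) /twist_comul !erM erV erJ mul1r mulr1.
exact: counitr.
Qed.

Let P (c : H) (t : tensor H H) : H := tlift (fun a b => S a * c * b) t.
Let R (c : H) (t : tensor H H) : H := tlift (fun a b => a * c * S b) t.

Let PM c s t : P c (s * t) = P (P c s) t.
Proof.
rewrite /P; move: s; apply: tens_ext => [||a b]; [lin|lin|].
move: t; apply: tens_ext => [||a' b']; [lin|lin|].
by rewrite tensM !tliftE ?antipodeM ?mulrA //; lin.
Qed.

Let RM c s t : R c (s * t) = R (R c t) s.
Proof.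
rewrite /R; move: s; apply: tens_ext => [||a b]; [lin|lin|].
move: t; apply: tens_ext => [||a' b']; [lin|lin|].
by rewrite tensM !tliftE ?antipodeM ?mulrA //; lin.
Qed.

Let P1 c : P c 1 = c.
Proof. by rewrite /P -tens1 tliftE ?antipode1 ?mul1r ?mulr1 //; lin. Qed.

Let R1 c : R c 1 = c.
Proof. by rewrite /R -tens1 tliftE ?antipode1 ?mul1r ?mulr1 //; lin. Qed.

Let PZ (c : k) t : P (c *: 1) t = c *: P 1 t.
Proof. by rewrite (@lin_scale _ _ _ (P^~ t)) // /P; lin. Qed.

Let RZ (c : k) t : R (c *: 1) t = c *: R 1 t.
Proof. by rewrite (@lin_scale _ _ _ (R^~ t)) // /R; lin. Qed.

Let PQ : P 1 J = Q.
Proof. by apply: eq_tlift => a b; rewrite mulr1. Qed.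

Let Pcomul h : P 1 (Δ h) = ε h *: 1.
Proof. by rewrite -antipodel; apply: eq_tlift => a b; rewrite mulr1. Qed.

Let Rcomul h : R 1 (Δ h) = ε h *: 1.
Proof. by rewrite -antipoder; apply: eq_tlift => a b; rewrite mulr1. Qed.

(* The linear map a ⊗ (b ⊗ c) |-> S a * b * S c.                              *)
Let N (t : tensor H (tensor H H)) : H :=
  tlift (fun a s => S a * tlift (fun b c => b * S c) s) t.

Let NE a b c : N (a ⊗ (b ⊗ c)) = S a * b * S c.
Proof. by rewrite /N !tliftE ?mulrA //; lin. Qed.

Let NPR s t : N (tassoc (s ⊗ (1 : H)) * ((1 : H) ⊗ t)) = P 1 s * R 1 t.
Proof.
rewrite /P /R; move: s; apply: tens_ext => [||a b]; [rewrite /N; lin|lin|].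
move: t; apply: tens_ext => [||a' b']; [rewrite /N; lin|lin|].
rewrite tassocE !tensM NE !tliftE; try lin.
by rewrite !mulr1 !mul1r !mulrA.
Qed.

Let Nel s t : N (tassoc (tmap Δ idfun s) * tmap idfun Δ t) = S (el s * er t).
Proof.
rewrite /el /er; move: s; apply: tens_ext => [||a b]; [rewrite /N; lin|lin|].
move: t; apply: tens_ext => [||c d]; [rewrite /N; lin|lin|].
rewrite !tmapE /= !tliftE; try lin.
have NN s t : N (tassoc (s ⊗ b) * (c ⊗ t)) = S c * P 1 s * R 1 t * S b.
  rewrite /P /R; move: s; apply: tens_ext => [||a1 a2]; [rewrite /N; lin|lin|].
  move: t; apply: tens_ext => [||d1 d2]; [rewrite /N; lin|lin|].
  rewrite tassocE !tensM NE !tliftE; try lin.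
  by rewrite !antipodeM !mulr1 !mulrA.
rewrite NN Pcomul Rcomul -!scalerAr -!scalerAl !mulr1 !linearZ /=.
by rewrite antipodeM !scalerA; congr (_ *: _); apply: mulrC.
Qed.

Let QR : Q * R 1 J^-1 = 1.
Proof.
have uJ := twist_unit hJ.
rewrite -PQ -NPR; transitivity (N (tassoc (tmap Δ idfun J^-1) * tmap idfun Δ J)).
  congr N; have := twist_cocycle hJ; rewrite rmorphM.
  move/(congr1 (fun z => tassoc (tmap Δ idfun J^-1) * z * ((1 : H) ⊗ J^-1))).
  rewrite !mulrA -!rmorphM /= mulVr // !rmorph1 mul1r => ->.
  by rewrite -mulrA tensM mulr1 divrr // tens1 mulr1.
by rewrite Nel elV erJ mulr1 antipode1.
Qed.

Lemma twistQ_unit : Q \is a GRing.unit.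
Proof.
apply/unitrP; exists (R 1 J^-1).
by split; [apply: falg_mulr1_unit QR | exact: QR].
Qed.

Lemma twistQV : Q^-1 = tlift (fun a b => a * S b) J^-1.
Proof.
transitivity (R 1 J^-1); last by apply: eq_tlift => a b; rewrite mulr1.
by rewrite -(mulKr twistQ_unit (R 1 J^-1)) QR mulr1.
Qed.

Fact twist_antipodel h :
  tlift (fun a b => twist_antipode a * b) (twist_comul hJ h) = ε h *: 1.
Proof.
transitivity (Q^-1 * P Q (J^-1 * Δ h * J)).
  rewrite (@comp_tlift _ _ _ _ _ (fun z => Q^-1 * z)); last by lin.
  by apply: eq_tlift => a b; rewrite !mulrA.
have PQV : P Q J^-1 = 1 by rewrite -PQ -PM divrr ?P1 ?(twist_unit hJ).
by rewrite !PM PQV Pcomul PZ PQ -scalerAr mulVr ?twistQ_unit.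
Qed.

Fact twist_antipoder h :
  tlift (fun a b => a * twist_antipode b) (twist_comul hJ h) = ε h *: 1.
Proof.
transitivity (R Q^-1 (J^-1 * Δ h * J) * Q).
  rewrite (@comp_tlift _ _ _ _ _ (fun z => z * Q)); last by lin.
  by apply: eq_tlift => a b; rewrite !mulrA.
have VR : Q^-1 = R 1 J^-1 by rewrite -(mulKr twistQ_unit (R 1 J^-1)) QR mulr1.
have RQV : R Q^-1 J = 1 by rewrite VR -RM divrr ?R1 ?(twist_unit hJ).
by rewrite !RM RQV Rcomul RZ -VR -scalerAl mulVr ?twistQ_unit.
Qed.

Definition twisted : hopfAlgebra H := @HopfAlgebra k H (twist_comul hJ) ε
  twist_antipode twist_comulA twist_comul_counitl twist_comul_counitr
  twist_antipodel twist_antipoder.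

End Twisting.

(* Main.v *)
Require Import Defs.
From HB Require Import structures.
From mathcomp Require Import all_boot all_algebra all_field.
From Stdlib Require Import Classical_Prop.

Set Implicit Arguments.
Unset Strict Implicit.
Unset Printing Implicit Defensive.

Import GRing.Theory.
Local Open Scope ring_scope.

(** Twisting changes neither the algebra H nor its counit, hence neither its
    integrals, so H^J is unimodular because H is. The content of the theorem is
    that H^J is cosemisimple.

    Cosemisimplicity is controlled by a coseparability form, that is, a linear
    form σ on H ⊗ H with x_1 σ(x_2 ⊗ y) = σ(x ⊗ y_1) y_2 and σ ∘ Δ = ε. Such a
    form averages any linear projection onto a subcoalgebra into a projection
    that is colinear on both sides, so that subcoalgebras have complements that
    are subcoalgebras (subcoalgebra_complement), and H is the direct sum of
    simple ones (coseparable_cosemisimple).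

    If H is cosemisimple, then the projection of H onto its subcoalgebra k1 is
    a two-sided integral λ of the dual of H with λ(1) = 1
    (cosemisimple_integral), and σ(x ⊗ y) = λ(x S(y)) is a coseparability form
    (integral_form_coseparability). Unimodularity of H adds one property: λ is
    invariant under the adjoint action, λ(a_1 x S(a_2)) = ε(a) λ(x)
    (integral_ad), which means that σ(Δ(a) w) = ε(a) σ(w). The companion
    σ(w Δ(a)) = ε(a) σ(w) always holds.

    These two rules make σ transport along the twist: w |-> σ(J w J^-1) is a
    coseparability form for H^J (coseparability_twist). It sends
    J^-1 Δ(x) J to σ(Δ(x)) = ε(x). By the cocycle identity, the two sides of
    the first axiom for H^J are the two sides of the axiom for H at J w J^-1,
    up to factors (id ⊗ Δ)(J) and (Δ ⊗ id)(J) and their inverses, on which σ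
    acts through ε; there the normalization of J makes them disappear.

    The adjoint invariance comes from Frobenius duality. The form λ(xy) is
    nondegenerate, so some t satisfies λ(xt) = ε(x) for all x; it is a left
    integral, hence a right one, and then t_1 λ(x t_2 S(a)) = S(x) a. Inserting
    1 = λ(t_1) t_2 after x in λ(a_1 x S(a_2)) gives λ(S(x) S(a_1) a_2), which is
    ε(a) λ(S(x)); a = 1 shows that λ(S(x)) = λ(x).

    Comments write Δ(x) = x_1 ⊗ x_2, summation understood. *)

(** * Calculus in Sweedler form *)

Lemma tlift_tens (k : fieldType) (U V : vectType k) (t : tensor U V) :
  tlift (fun a b => a ⊗ b) t = t.
Proof. by move: t; apply: tens_ext => [||u v]; [lin|lin|rewrite tliftE //; lin]. Qed.

Lemma tlift_sum (k : fieldType) (U V : vectType k) (W : lmodType k) (I : finType)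
    (F : I -> U -> V -> W) (t : tensor U V) :
  tlift (fun a b => \sum_i F i a b) t = \sum_i tlift (F i) t.
Proof.
rewrite /tlift; under eq_bigr do under eq_bigr do rewrite scaler_sumr.
rewrite [RHS]exchange_big; apply: eq_bigr => p _.
by rewrite [RHS]exchange_big.
Qed.

Section Sweedler.
Variables (k : fieldType) (H : falgType k) (hH : hopfAlgebra H).
Local Notation Δ := (comul hH).
Local Notation ε := (counit hH).
Local Notation S := (antipode hH).

Section Linear.
Variable W : lmodType k.
Implicit Types (G : H -> W) (F : H -> H -> W).

Lemma counitl_lin G x : lin G -> tlift (fun a b => ε a *: G b) (Δ x) = G x.
Proof.
move=> lG; rewrite -{2}(counitl hH x) comp_tlift //.
by apply: eq_tlift => a b; rewrite lin_scale.
Qed.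

Lemma counitr_lin G x : lin G -> tlift (fun a b => ε b *: G a) (Δ x) = G x.
Proof.
move=> lG; rewrite -{2}(counitr hH x) comp_tlift //.
by apply: eq_tlift => a b; rewrite lin_scale.
Qed.

Lemma antipodel_lin G x :
  lin G -> tlift (fun a b => G (S a * b)) (Δ x) = ε x *: G 1.
Proof. by move=> lG; rewrite -lin_scale // -antipodel comp_tlift. Qed.

Lemma antipoder_lin G x :
  lin G -> tlift (fun a b => G (a * S b)) (Δ x) = ε x *: G 1.
Proof. by move=> lG; rewrite -lin_scale // -antipoder comp_tlift. Qed.

(** This is the form in which multiplicativity of Δ enters the calculations
    with x_1 ⊗ x_2: it gives the components of Δ(xy). *)
Lemma tlift_mul F (s t : tensor H H) :
  (forall b, lin (F^~ b)) -> (forall a, lin (F a)) ->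
  tlift F (s * t) = tlift (fun a b => tlift (fun c d => F (a * c) (b * d)) t) s.
Proof.
move=> l1 l2.
have m1 (c b : H) : lin (fun a => F (a * c) b).
  by move=> u x y; rewrite mulrDl -scalerAl l1.
have m2 (a c : H) : lin (fun b => F a (b * c)).
  by move=> u x y; rewrite mulrDl -scalerAl l2.
have m3 (c b : H) : lin (fun a => F (c * a) b).
  by move=> u x y; rewrite mulrDr -scalerAr l1.
have m4 (a c : H) : lin (fun b => F a (c * b)).
  by move=> u x y; rewrite mulrDr -scalerAr l2.
move: s; apply: tens_ext => [||a b]; [|lin|].
  by move=> u x y; rewrite mulrDl -scalerAl linearP.
rewrite tliftE; try lin.
move: t; apply: tens_ext => [||c d]; [|lin|].
  by move=> u x y; rewrite mulrDr -scalerAr linearP.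
by rewrite tensM !tliftE //; lin.
Qed.

End Linear.

Lemma comul_tens y : Δ y = tlift (fun a b => a ⊗ b) (Δ y).
Proof. by rewrite tlift_tens. Qed.

(** Both sides are convolution inverses of Δ, as maps from H to H ⊗ H: the left
    one because Δ is an algebra morphism, the right one, T below, because
    x_1 S(x_4) ⊗ x_2 S(x_3) collapses from the inside. *)
Lemma antipode_comul x : Δ (S x) = tlift (fun a b => S b ⊗ S a) (Δ x).
Proof.
pose T y : tensor H H := tlift (fun a b => S b ⊗ S a) (Δ y).
have lT : lin T by rewrite /T; lin.
have ΔT y : tlift (fun a b => Δ a * T b) (Δ y) = (ε y : k) *: (1 : tensor H H).
  transitivity (tlift (fun a b => tlift (fun b1 b2 => tlift (fun c d =>
      (a * S d) ⊗ (b1 * S c)) (Δ b2)) (Δ b)) (Δ y)).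
    rewrite -(coassoc3 hH (F := fun a b1 b2 => tlift (fun c d =>
      (a * S d) ⊗ (b1 * S c)) (Δ b2))); try lin.
    apply: eq_tlift => a b.
    rewrite -{1}(tlift_tens (Δ a)).
    rewrite (@comp_tlift _ _ _ _ _ (fun z => z * T b)); last by lin.
    apply: eq_tlift => a1 a2.
    rewrite /T (@comp_tlift _ _ _ _ _ (fun z => (a1 ⊗ a2) * z)); last by lin.
    by apply: eq_tlift => c d; rewrite tensM.
  transitivity (tlift (fun a b => (a * S b) ⊗ (1 : H)) (Δ y)).
    apply: eq_tlift => a b.
    rewrite -(coassoc3 hH (F := fun b1 c d => (a * S d) ⊗ (b1 * S c))); try lin.
    rewrite -(@counitl_lin _ (fun d => (a * S d) ⊗ (1 : H)) b); last by lin.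
    apply: eq_tlift => b1 d.
    by rewrite (@antipoder_lin _ (fun z => (a * S d) ⊗ z)); last by lin.
  by rewrite (@antipoder_lin _ (fun z => z ⊗ (1 : H))); last by lin.
transitivity (tlift (fun a b => tlift (fun b1 b2 => Δ (S a) * (Δ b1 * T b2))
    (Δ b)) (Δ x)).
  rewrite -(@counitr_lin _ (fun z => Δ (S z))); last by lin.
  apply: eq_tlift => a b.
  rewrite -(@comp_tlift _ _ _ _ _ (fun z => Δ (S a) * z)); last by lin.
  by rewrite ΔT -scalerAr mulr1.
rewrite -(coassoc3 hH (F := fun a b1 b2 => Δ (S a) * (Δ b1 * T b2))); try lin.
rewrite -/(T x) -(@counitl_lin _ T x) //; apply: eq_tlift => a b.
transitivity (tlift (fun a1 a2 => Δ (S a1 * a2) * T b) (Δ a)).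
  by apply: eq_tlift => a1 a2; rewrite rmorphM mulrA.
by rewrite (@antipodel_lin _ (fun z => Δ z * T b)) ?rmorph1 ?mul1r; last by lin.
Qed.

End Sweedler.

(** * Integrals of the dual *)

Section Integrals.
Variables (k : fieldType) (H : falgType k) (hH : hopfAlgebra H).
Local Notation Δ := (comul hH).
Local Notation ε := (counit hH).
Local Notation S := (antipode hH).
Variable λ : {linear H -> k^o}.
Hypothesis λ_left : forall x, tlift (fun a b => λ b *: a) (Δ x) = λ x *: 1.
Hypothesis λ1 : λ 1 = 1.

(** The left integral identity for xy is x_1 y_1 λ(x_2 y_2) = λ(xy) 1; applied
    to the second component of x and multiplied by S of the first one, it moves
    the free factor from y to x. *)
Lemma integral_antipodel x y :
  tlift (fun c d => λ (x * d) *: c) (Δ y) =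
  tlift (fun a b => λ (b * y) *: S a) (Δ x).
Proof.
transitivity (tlift (fun a b => tlift (fun b1 b2 =>
    tlift (fun c d => λ (b2 * d) *: (S a * (b1 * c))) (Δ y)) (Δ b)) (Δ x)).
  rewrite -(coassoc3 hH (F := fun a b1 b2 =>
    tlift (fun c d => λ (b2 * d) *: (S a * (b1 * c))) (Δ y))); try lin.
  rewrite -(@counitl_lin _ _ hH _
    (fun z => tlift (fun c d => λ (z * d) *: c) (Δ y)) x); last by lin.
  apply: eq_tlift => a b.
  transitivity (tlift (fun a1 a2 =>
      tlift (fun c d => λ (b * d) *: (S a1 * a2 * c)) (Δ y)) (Δ a)).
    rewrite (@antipodel_lin _ _ hH _ (fun z =>
      tlift (fun c d => λ (b * d) *: (z * c)) (Δ y))); last by lin.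
    by congr (_ *: _); apply: eq_tlift => c d; rewrite mul1r.
  by apply: eq_tlift => a1 a2; apply: eq_tlift => c d; rewrite mulrA.
apply: eq_tlift => a b.
transitivity (S a * (λ (b * y) *: 1)); last by rewrite -scalerAr mulr1.
rewrite -λ_left rmorphM tlift_mul; try lin.
rewrite (@comp_tlift _ _ _ _ _ (fun z => S a * z)); last by lin.
apply: eq_tlift => b1 b2.
rewrite (@comp_tlift _ _ _ _ _ (fun z => S a * z)); last by lin.
by apply: eq_tlift => c d; rewrite -scalerAr.
Qed.

(** The left integral identity for x S(y_1), multiplied by y_2 on the right; the
    components of Δ(S(y_1)) come in the reverse order, so that the free one
    meets y_2 and cancels. *)
Lemma integral_form_balanced x y :
  tlift (fun a b => λ (b * S y) *: a) (Δ x) =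
  tlift (fun c d => λ (x * S c) *: d) (Δ y).
Proof.
transitivity (tlift (fun c d => tlift (fun c1 c2 => tlift (fun a b =>
   λ (b * S c1) *: (a * S c2 * d)) (Δ x)) (Δ c)) (Δ y)).
  rewrite (coassoc3 hH (F := fun c1 c2 d => tlift (fun a b =>
    λ (b * S c1) *: (a * S c2 * d)) (Δ x))); try lin.
  rewrite -(@counitr_lin _ _ hH _
    (fun z => tlift (fun a b => λ (b * S z) *: a) (Δ x)) y); last by lin.
  apply: eq_tlift => c d.
  transitivity (tlift (fun d1 d2 =>
      tlift (fun a b => λ (b * S c) *: (a * (S d1 * d2))) (Δ x)) (Δ d)).
    rewrite (@antipodel_lin _ _ hH _ (fun z =>
      tlift (fun a b => λ (b * S c) *: (a * z)) (Δ x))); last by lin.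
    by congr (_ *: _); apply: eq_tlift => a b; rewrite mulr1.
  by apply: eq_tlift => d1 d2; apply: eq_tlift => a b; rewrite mulrA.
apply: eq_tlift => c d.
transitivity ((λ (x * S c) *: 1) * d); last by rewrite -scalerAl mul1r.
rewrite -λ_left rmorphM tlift_mul; try lin.
rewrite [X in _ = X * d]tlift_exchange /= antipode_comul.
rewrite (@comp_tlift _ _ _ _ _ (fun z =>
  tlift (fun c d => tlift (fun a b => λ (b * d) *: (a * c)) (Δ x)) z)); last by lin.
rewrite (@comp_tlift _ _ _ _ _ (fun z => z * d)); last by lin.
apply: eq_tlift => c1 c2.
rewrite tliftE; try lin.
rewrite (@comp_tlift _ _ _ _ _ (fun z => z * d)); last by lin.
by apply: eq_tlift => a b; rewrite -scalerAl.
Qed.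

(** The space of such y is a left coideal, by
    integral_antipodel, and y = y_1 λ(S(y_2) y_3) because λ(1) = 1. *)
Lemma integral_nondegenerate (y : H) : (forall x, λ (x * y) = 0) -> y = 0.
Proof.
move=> y0.
have zero (x : H) : tlift (fun c d => λ (x * d) *: c) (Δ y) = 0.
  by rewrite integral_antipodel /tlift; apply: big1 => i _; apply: big1 => j _;
     rewrite y0 scale0r scaler0.
(* The sum y_1 λ(S(y_2) y_3) contracts to y, but grouped as (y_1, y_2), y_3 it  *)
(* only involves the vanishing values λ(x y_3).                                 *)
transitivity (tlift (fun a b : H =>
    tlift (fun b1 b2 : H => λ (S b1 * b2) *: a) (Δ b)) (Δ y)).
  rewrite -{1}(counitr hH y); apply: eq_tlift => a b.
  by rewrite (@antipodel_lin _ _ hH _ (fun z => λ z *: (a : H))) ?λ1 ?scale1r //; lin.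
rewrite -(coassoc3 hH (F := fun a b1 b2 : H => λ (S b1 * b2) *: a)); try lin.
(* Expanding y_2 in a basis separates it from y_1 ⊗ y_3.                       *)
transitivity (\sum_i tlift (fun a1 a2 : H => (coord (vbasis {:H}) i a2 : k^o) *: a1)
    (Δ (tlift (fun a b : H => λ (S (vbasis {:H})`_i * b) *: a) (Δ y)))); last first.
  apply: big1 => i _; rewrite zero !linear0 //.
transitivity (\sum_i tlift (fun a b : H => tlift (fun a1 a2 : H =>
  (coord (vbasis {:H}) i a2 : k^o) *: (λ (S (vbasis {:H})`_i * b) *: a1)) (Δ a)) (Δ y)).
  rewrite -tlift_sum; apply: eq_tlift => a b.
  rewrite -tlift_sum; apply: eq_tlift => a1 a2.
  rewrite {1}(coord_vbasis (memvf a2)).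
  rewrite (@lin_sum _ _ _ (fun z => λ (S z * b) *: a1)) //; lin.
apply: eq_bigr => i _.
rewrite (@comp_tlift _ _ _ _ _ (fun z => tlift (fun a1 a2 : H =>
  (coord (vbasis {:H}) i a2 : k^o) *: a1) (Δ z))); last by lin.
apply: eq_tlift => a b.
have lG : lin (fun z => tlift (fun a1 a2 : H =>
  (coord (vbasis {:H}) i a2 : k^o) *: a1) (Δ z)) by lin.
rewrite (lin_scale _ _ lG).
rewrite (@comp_tlift _ _ _ _ _ (fun z : H =>
  (λ (S (vbasis {:H})`_i * b) : k) *: z)); last by lin.
by apply: eq_tlift => a1 a2; rewrite !scalerA mulrC.
Qed.

End Integrals.

(** In finite dimension the injective map sending y to the form λ(- y) is onto
    the dual. *)
Lemma nondegenerate_represent (k : fieldType) (A : falgType k) (λ e : {linear A -> k^o}) :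
  (forall y, (forall x, λ (x * y) = 0) -> y = 0) ->
  exists t, forall x, λ (x * t) = e x.
Proof.
move=> l0; set X := vbasis {:A}.
have fX : free X by apply: basis_free (vbasisP _).
(* phi y encodes the form by its values on a basis, so as to get a linear map  *)
(* from A to itself.                                                           *)
pose phi (y : A) := \sum_(i < \dim {:A}) (λ (X`_i * y) : k) *: X`_i.
have lphi : linear phi.
  move=> c y z; rewrite /phi scaler_sumr -big_split; apply: eq_bigr => i _ /=.
  by rewrite mulrDr -scalerAr linearP scalerDl scalerA.
pose phiL : {linear A -> A} := HB.pack phi (GRing.isLinear.Build _ _ _ _ phi lphi).
pose Phi : 'End(A) := linfun phiL.
have PhiE y : Phi y = phi y by rewrite (lfunE phiL).
have XX (g : A -> k^o) (x : A) : lin g ->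
    g x = \sum_(i < \dim {:A}) coord X i x *: g X`_i.
  by move=> lg; rewrite {1}(coord_vbasis (memvf x)) lin_sum.
have lY y : lin (fun x : A => λ (x * y)) by lin.
have ker0 : lker Phi == 0%VS.
  apply/lker0P=> u v /eqP; rewrite -subr_eq0 -linearB /= PhiE => /eqP uv.
  apply/eqP; rewrite -subr_eq0; apply/eqP; apply: l0 => x.
  rewrite (XX _ x (lY _)).
  apply: big1 => i _; move/(congr1 (coord X i)): uv.
  by rewrite coord_sum_free // linear0 => ->; rewrite scaler0.
pose v := \sum_(i < \dim {:A}) (e X`_i : k) *: X`_i.
exists (Phi^-1%VF v) => x; set t := (Phi^-1)%VF _.
have tE : phi t = v by rewrite -PhiE lker0_lfunVK.
rewrite (XX _ x (lY t)) (XX e x); last exact: linearP.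
apply: eq_bigr => i _; move/(congr1 (coord X i)): tE.
by rewrite !coord_sum_free // => ->.
Qed.

(** * Adjoint invariance from unimodularity *)

Section AdInvariance.
Variables (k : fieldType) (H : falgType k) (hH : hopfAlgebra H).
Local Notation Δ := (comul hH).
Local Notation ε := (counit hH).
Local Notation S := (antipode hH).
Variable λ : {linear H -> k^o}.
Hypothesis λ_left : forall x, tlift (fun a b => λ b *: a) (Δ x) = λ x *: 1.
Hypothesis λ_right : forall x, tlift (fun a b => λ a *: b) (Δ x) = λ x *: 1.
Hypothesis λ1 : λ 1 = 1.
Hypothesis uniH : unimodular hH.

(** The t that represents ε is a left integral, since λ(x h t) = ε(x) ε(h) for
    all x. *)
Lemma unimodular_dual_integral :
  exists2 t, right_integral hH t & forall x, λ (x * t) = ε x.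
Proof.
have nd := integral_nondegenerate λ_left λ1.
have [t tE] := nondegenerate_represent ε nd.
exists t => //; apply/uniH => h; apply/eqP; rewrite -subr_eq0; apply/eqP.
apply: nd => x; rewrite mulrBr linearB /= mulrA -scalerAr linearZ /= !tE rmorphM.
by rewrite mulrC subrr.
Qed.

(** t_1 a ⊗ t_2 = t_1 a_1 ⊗ t_2 a_2 S(a_3) = t_1 ⊗ t_2 S(a). *)
Lemma right_integral_shift (W : lmodType k) (F : H -> H -> W) t a :
  (forall b, lin (F^~ b)) -> (forall a, lin (F a)) -> right_integral hH t ->
  tlift (fun u v => F (u * a) v) (Δ t) = tlift (fun u v => F u (v * S a)) (Δ t).
Proof.
move=> l1 l2 tr.
have m1 (c : H) b : lin (fun a => F (c * a) b).
  by move=> u x y; rewrite mulrDr -scalerAr l1.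
have m2 c (b d : H) : lin (fun a => F c (b * a * d)).
  by move=> u x y; rewrite mulrDr mulrDl -scalerAr -scalerAl l2.
have m3 c (b d : H) : lin (fun a => F c (b * d * S a)).
  by move=> u x y; rewrite linearP mulrDr -scalerAr l2.
have m4 c (b d : H) : lin (fun a => F c (b * (d * S a))).
  by move=> u x y; rewrite linearP !mulrDr -!scalerAr l2.
have m8 c (b : H) : lin (fun a => F c (b * S a)).
  by move=> u x y; rewrite linearP mulrDr -scalerAr l2.
have m5 (c : H) : lin (fun a => F a c) by [].
have m6 c (b : H) : lin (fun a => F c (b * a)).
  by move=> u x y; rewrite mulrDr -scalerAr l2.
have m7 c (b : H) : lin (fun a => F c (a * b)).
  by move=> u x y; rewrite mulrDl -scalerAl l2.
transitivity (tlift (fun a1 a2 => tlift (fun c d => tlift (fun u v =>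
   F (u * c) (v * d * S a2)) (Δ t)) (Δ a1)) (Δ a)).
  rewrite (coassoc3 hH (F := fun c d a2 => tlift (fun u v =>
   F (u * c) (v * d * S a2)) (Δ t))); try lin.
  rewrite -(@counitr_lin _ _ hH _
    (fun z => tlift (fun u v => F (u * z) v) (Δ t)) a); last by lin.
  apply: eq_tlift => c b.
  transitivity (tlift (fun b1 b2 =>
      tlift (fun u v => F (u * c) (v * (b1 * S b2))) (Δ t)) (Δ b)).
    rewrite (@antipoder_lin _ _ hH _ (fun z =>
      tlift (fun u v => F (u * c) (v * z)) (Δ t))); last by lin.
    by congr (_ *: _); apply: eq_tlift => u v; rewrite mulr1.
  by apply: eq_tlift => b1 b2; apply: eq_tlift => u v; rewrite mulrA.
rewrite -[RHS](@counitl_lin _ _ hH _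
  (fun z => tlift (fun u v => F u (v * S z)) (Δ t)) a); last by lin.
apply: eq_tlift => a1 a2.
rewrite tlift_exchange -(@tlift_mul _ _ _ (fun u v => F u (v * S a2))) //.
have lG : lin (fun z => tlift (fun u v => F u (v * S a2)) (Δ z)) by lin.
by rewrite -rmorphM tr (lin_scale _ _ lG).
Qed.

(** This amounts to the commutation rule λ(y S(b)) = λ(S^-1(b) y), which makes
    S^-1(a_2) a_1 appear. The identity t_1 λ(y t_2 S(b)) = S(y) b, named key,
    gives it without inverting S. *)
Lemma integral_ad a x : tlift (fun b c => λ (b * x * S c)) (Δ a) = ε a * λ x.
Proof.
have [t tr tE] := unimodular_dual_integral.
have lt1 : λ t = 1 by rewrite -[t]mul1r tE rmorph1.
have key y b : tlift (fun u v => λ (y * v * S b) *: u) (Δ t) = S y * b.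
  transitivity (tlift (fun u v => λ (y * (v * S b)) *: u) (Δ t)).
    by apply: eq_tlift => u v; rewrite mulrA.
  rewrite -(@right_integral_shift _ (fun u v => λ (y * v) *: u)) //; try lin.
  transitivity (tlift (fun u v => λ (y * v) *: u) (Δ t) * b).
    rewrite (@comp_tlift _ _ _ _ _ (fun z => z * b)); last by lin.
    by apply: eq_tlift => u v; rewrite scalerAl.
  rewrite integral_antipodel //; congr (_ * b).
  rewrite -{2}(counitr hH y) (@comp_tlift _ _ _ _ _ S); last by lin.
  by apply: eq_tlift => u v; rewrite tE linearZ.
have main b y : tlift (fun c d => λ (c * y * S d)) (Δ b) = ε b * λ (S y).
  (* As 1 = λ(t_1) t_2, this inserts t_2 after y; key then removes it.         *)
  transitivity (tlift (fun u v =>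
      tlift (fun c d => λ u *: λ (c * y * v * S d)) (Δ b)) (Δ t) : k^o).
    transitivity (tlift (fun c d => λ (c * y * (λ t *: 1) * S d)) (Δ b) : k^o).
      by apply: eq_tlift => c d; rewrite lt1 scale1r mulr1.
    rewrite tlift_exchange; apply: eq_tlift => c d.
    rewrite -λ_right (@comp_tlift _ _ _ _ _ (fun z => λ (c * y * z * S d))); last by lin.
    by apply: eq_tlift => u v; rewrite -scalerAr -scalerAl linearZ.
  rewrite tlift_exchange.
  transitivity (tlift (fun c d => λ (S y * (S c * d))) (Δ b)).
    apply: eq_tlift => c d; rewrite mulrA -antipodeM -key.
    rewrite (comp_tlift (L := λ)); last by lin.
    by apply: eq_tlift => u v; rewrite linearZ; apply: mulrC.
  by rewrite (@antipodel_lin _ _ hH _ (fun z => λ (S y * z))) ?mulr1 //; lin.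
rewrite main; congr (_ * _); have := main 1 x.
by rewrite !rmorph1 -tens1 tliftE ?antipode1 ?mulr1 ?mul1r => [->||]; [|lin|lin].
Qed.

End AdInvariance.

(** * Coseparability forms *)

(** Under the identification of forms on H ⊗ H with elements of the tensor
    square of the dual algebra, this is a separability idempotent of the
    dual. *)
Definition coseparability (k : fieldType) (H : falgType k) (hH : hopfAlgebra H)
    (σ : {linear tensor H H -> k^o}) : Prop :=
  (forall x y, tlift (fun a b => σ (b ⊗ y) *: a) (comul hH x) =
               tlift (fun c d => σ (x ⊗ c) *: d) (comul hH y)) /\
  (forall x, σ (comul hH x) = counit hH x).

Section IntegralForm.
Variables (k : fieldType) (H : falgType k) (hH : hopfAlgebra H).
Local Notation Δ := (comul hH).
Local Notation ε := (counit hH).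
Local Notation S := (antipode hH).
Variable λ : {linear H -> k^o}.

Definition integral_form : tensor H H -> k^o := tlift (fun a b => λ (a * S b)).
HB.instance Definition _ := GRing.Linear.on integral_form.

Lemma integral_formE a b : integral_form (a ⊗ b) = λ (a * S b).
Proof. by rewrite /integral_form tliftE //; lin. Qed.

Hypothesis λ_left : forall x, tlift (fun a b => λ b *: a) (Δ x) = λ x *: 1.
Hypothesis λ_right : forall x, tlift (fun a b => λ a *: b) (Δ x) = λ x *: 1.
Hypothesis λ1 : λ 1 = 1.

Lemma integral_form_coseparability : coseparability hH integral_form.
Proof.
split=> [x y|x].
  transitivity (tlift (fun a b => λ (b * S y) *: a) (Δ x)).
    by apply: eq_tlift => a b; rewrite /= integral_formE.
  rewrite integral_form_balanced //.
  by apply: eq_tlift => a b; rewrite /= integral_formE.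
rewrite /= /integral_form (@antipoder_lin _ _ hH _ λ); last exact: linearP.
by rewrite λ1; apply: mulr1.
Qed.

Lemma integral_form_mulr a w :
  integral_form (w * Δ a) = ε a * integral_form w.
Proof.
move: w; apply: tens_ext => [||p q]; [lin|exact/lin_scaler/linearP|].
transitivity (tlift (fun b c => λ (p * (b * S c) * S q)) (Δ a)).
  move: (Δ a); apply: tens_ext => [||b c]; [lin|lin|].
  by rewrite tensM integral_formE tliftE ?antipodeM ?mulrA //; lin.
rewrite (@antipoder_lin _ _ hH _ (fun z => λ (p * z * S q))); last by lin.
by rewrite mulr1 integral_formE.
Qed.

Hypothesis uniH : unimodular hH.

Lemma integral_form_mull a w :
  integral_form (Δ a * w) = ε a * integral_form w.
Proof.
move: w; apply: tens_ext => [||p q]; [lin|exact/lin_scaler/linearP|].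
rewrite integral_formE -integral_ad //.
move: (Δ a); apply: tens_ext => [||b c]; [lin|lin|].
by rewrite tensM integral_formE tliftE ?antipodeM ?mulrA //; lin.
Qed.

End IntegralForm.

(** * Transport of the form along a twist *)

Section Contractions.
Variables (k : fieldType) (H : falgType k).
Local Notation HH := (tensor H H).
Implicit Types (σ : {linear HH -> k^o}) (u : tensor H HH).

(** These contractions state the coseparability axiom for a whole tensor, so
    that it can be multiplied by elements of the triple tensor product: the two
    sides of the axiom are contract23 of (Δ ⊗ id)(x ⊗ y) and contract12 of
    (id ⊗ Δ)(x ⊗ y). *)
Definition contract23 σ u : H := tlift (fun a w => σ w *: a) u.
Definition contract12 σ u : H :=
  tlift (fun a w => tlift (fun b c => σ (a ⊗ b) *: c) w) u.

Lemma contract23E σ a w : contract23 σ (a ⊗ w) = σ w *: a.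
Proof. by rewrite /contract23 tliftE //; lin. Qed.

Lemma contract12E σ w c : contract12 σ (tassoc (w ⊗ c)) = σ w *: c.
Proof.
rewrite /contract12; move: w; apply: tens_ext => [||a b]; [lin|lin|].
by rewrite tassocE !tliftE //; lin.
Qed.

Lemma tassoc_ext (W : lmodType k) (f g : tensor H HH -> W) : lin f -> lin g ->
  (forall w c, f (tassoc (w ⊗ c)) = g (tassoc (w ⊗ c))) -> f =1 g.
Proof.
move=> lf lg fg u; move: u; apply: tens_ext => // a w.
move: w; apply: tens_ext => [||b c].
- by move=> x y z; rewrite -lf; congr f; apply: (tens_linr a (@lin_id _ _) x y z).
- by move=> x y z; rewrite -lg; congr g; apply: (tens_linr a (@lin_id _ _) x y z).
by rewrite -tassocE fg.
Qed.

Variable hH : hopfAlgebra H.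
Local Notation Δ := (comul hH).
Local Notation ε := (counit hH).

Definition counit_left (t : HH) : H := tlift (fun a b => ε a *: b) t.
Definition counit_right (t : HH) : H := tlift (fun a b => ε b *: a) t.

Lemma counit_leftM t t' : counit_left (t * t') = counit_left t * counit_left t'.
Proof.
apply: (@tens_multiplicative _ _ _ _ counit_left); rewrite /counit_left; first by lin.
move=> a b a' b'; rewrite tensM !tliftE; try lin.
by rewrite rmorphM -scalerAl -scalerAr scalerA.
Qed.

Lemma counit_rightM t t' : counit_right (t * t') = counit_right t * counit_right t'.
Proof.
apply: (@tens_multiplicative _ _ _ _ counit_right); rewrite /counit_right; first by lin.
move=> a b a' b'; rewrite tensM !tliftE; try lin.
by rewrite rmorphM -scalerAl -scalerAr scalerA.
Qed.

Lemma contract23_comul σ x y : contract23 σ (tassoc (tmap Δ idfun (x ⊗ y))) =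
  tlift (fun a b => σ (b ⊗ y) *: a) (Δ x).
Proof.
rewrite tmapE /=; move: (Δ x); apply: tens_ext => [||a b].
- by rewrite /contract23; lin.
- by lin.
by rewrite tassocE contract23E tliftE //; lin.
Qed.

Lemma contract12_comul σ x y : contract12 σ (tmap idfun Δ (x ⊗ y)) =
  tlift (fun c d => σ (x ⊗ c) *: d) (Δ y).
Proof. by rewrite tmapE /contract12 tliftE //; lin. Qed.

Variable σ : {linear HH -> k^o}.
Hypothesis σ_mull : forall a w, σ (Δ a * w) = ε a * σ w.
Hypothesis σ_mulr : forall a w, σ (w * Δ a) = ε a * σ w.

(** Of p ⊗ Δ(q), the form σ meets only Δ(q), which it turns into ε(q); what
    is left is p ε(q). *)
Lemma contract23_mull t u :
  contract23 σ (tmap idfun Δ t * u) = counit_right t * contract23 σ u.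
Proof.
move: t; apply: tens_ext => [||p q].
- by rewrite /contract23; lin.
- by rewrite /counit_right; lin.
move: u; apply: tens_ext => [||a w].
- by rewrite /contract23; lin.
- by rewrite /contract23; lin.
rewrite tmapE tensM !contract23E σ_mull /counit_right tliftE; try lin.
by rewrite -scalerAl -scalerAr scalerA.
Qed.

Lemma contract23_mulr t u :
  contract23 σ (u * tmap idfun Δ t) = contract23 σ u * counit_right t.
Proof.
move: t; apply: tens_ext => [||p q].
- by rewrite /contract23; lin.
- by rewrite /counit_right; lin.
move: u; apply: tens_ext => [||a w].
- by rewrite /contract23; lin.
- by rewrite /contract23; lin.
rewrite tmapE tensM !contract23E σ_mulr /counit_right tliftE; try lin.
by rewrite -scalerAl -scalerAr scalerA; congr (_ *: _); apply: mulrC.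
Qed.

Lemma contract12_mull t u :
  contract12 σ (tassoc (tmap Δ idfun t) * u) = counit_left t * contract12 σ u.
Proof.
move: t; apply: tens_ext => [||p q].
- by rewrite /contract12; lin.
- by rewrite /counit_left; lin.
move: u; apply: tassoc_ext => [||w c].
- by rewrite /contract12; lin.
- by rewrite /contract12; lin.
rewrite -rmorphM tmapE tensM !contract12E σ_mull /counit_left tliftE; try lin.
by rewrite -scalerAl -scalerAr scalerA.
Qed.

Lemma contract12_mulr t u :
  contract12 σ (u * tassoc (tmap Δ idfun t)) = contract12 σ u * counit_left t.
Proof.
move: t; apply: tens_ext => [||p q].
- by rewrite /contract12; lin.
- by rewrite /counit_left; lin.
move: u; apply: tassoc_ext => [||w c].
- by rewrite /contract12; lin.
- by rewrite /contract12; lin.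
rewrite -rmorphM tmapE tensM !contract12E σ_mulr /counit_left tliftE; try lin.
by rewrite -scalerAl -scalerAr scalerA; congr (_ *: _); apply: mulrC.
Qed.

End Contractions.

Section Twist.
Variables (k : fieldType) (H : falgType k) (hH : hopfAlgebra H) (J : tensor H H)
  (hJ : is_twist hH J).
Local Notation Δ := (comul hH).
Local Notation ε := (counit hH).
Local Notation HH := (tensor H H).
Variable σ : {linear HH -> k^o}.

Definition conj_form (t : HH) : k^o := σ (J * t * J^-1).
Fact conj_form_linear : linear conj_form.
Proof. by change (lin conj_form); rewrite /conj_form; lin. Qed.
HB.instance Definition _ :=
  GRing.isLinear.Build k HH k^o _ conj_form conj_form_linear.

Lemma contract23_conj u :
  contract23 conj_form u = contract23 σ (((1 : H) ⊗ J) * u * ((1 : H) ⊗ J^-1)).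
Proof.
move: u; apply: tens_ext => [||a w].
- by rewrite /contract23; lin.
- by rewrite /contract23; lin.
by rewrite contract23E !tensM mul1r mulr1 contract23E.
Qed.

Lemma contract12_conj u : contract12 conj_form u =
  contract12 σ (tassoc (J ⊗ (1 : H)) * u * tassoc (J^-1 ⊗ (1 : H))).
Proof.
move: u; apply: tassoc_ext => [||w c].
- by rewrite /contract12; lin.
- by rewrite /contract12; lin.
by rewrite contract12E -!rmorphM !tensM mul1r mulr1 contract12E.
Qed.

Hypothesis σP : coseparability hH σ.
Hypothesis σ_mull : forall a w, σ (Δ a * w) = ε a * σ w.
Hypothesis σ_mulr : forall a w, σ (w * Δ a) = ε a * σ w.

(** With the leg notation J12 = J ⊗ 1 and J23 = 1 ⊗ J, the cocycle identity
    turns J12 J23^-1 into (Δ ⊗ id)(J^-1) (id ⊗ Δ)(J), and likewise for its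
    inverse. In contract23 the outer factors (id ⊗ Δ)(J^-1) and (id ⊗ Δ)(J) are
    then absorbed, and in contract12 the factors (Δ ⊗ id)(J^-1) and
    (Δ ⊗ id)(J); what remains is the axiom for σ at J (x ⊗ y) J^-1. *)
Lemma coseparability_twist : coseparability (twisted hJ) conj_form.
Proof.
have uJ := twist_unit hJ.
split=> [x y|x]; last first.
  change (σ (J * (J^-1 * Δ x * J) * J^-1) = ε x).
  rewrite !mulrA divrr // mul1r -mulrA divrr // mulr1.
  exact: σP.2.
rewrite -(contract23_comul (twisted hJ)) -(contract12_comul (twisted hJ)) /=.
set t := x ⊗ y.
rewrite tmap_twistl tmap_twistr !rmorphM /= contract23_conj contract12_conj.
set j12 := tassoc (J ⊗ _); set v12 := tassoc (J^-1 ⊗ _).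
set j23 := _ ⊗ J; set v23 := _ ⊗ J^-1.
pose A := tassoc (tmap Δ idfun J); pose A' := tassoc (tmap Δ idfun J^-1).
pose B := tmap idfun Δ J; pose B' := tmap idfun Δ J^-1.
have cocycle : A * j12 = B * j23 by rewrite -rmorphM; apply: twist_cocycle hJ.
have A'A : A' * A = 1 by rewrite -!rmorphM mulVr // !rmorph1.
have B'B : B' * B = 1 by rewrite -rmorphM mulVr // rmorph1.
have jv12 : j12 * v12 = 1 by rewrite -rmorphM tensM divrr // mulr1 tens1 rmorph1.
have jv23 : j23 * v23 = 1 by rewrite tensM divrr // mulr1 tens1.
have jv : j12 * v23 = A' * B.
  by rewrite -[j12]mul1r -A'A -(mulrA A') cocycle !mulrA -mulrA jv23 mulr1.
have vj : j23 * v12 = B' * A.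
  by rewrite -[j23]mul1r -B'B -(mulrA B') -cocycle !mulrA -mulrA jv12 mulr1.
have cl1 : counit_left hH 1 = 1.
  by rewrite /counit_left -tens1 tliftE ?rmorph1 ?scale1r //; lin.
have cr1 : counit_right hH 1 = 1.
  by rewrite /counit_right -tens1 tliftE ?rmorph1 ?scale1r //; lin.
have clJ : counit_left hH J = 1 := twist_counitl hJ.
have crJ : counit_right hH J = 1 := twist_counitr hJ.
have clV : counit_left hH J^-1 = 1.
  by rewrite -[LHS]mulr1 -clJ -counit_leftM mulVr ?cl1.
have crV : counit_right hH J^-1 = 1.
  by rewrite -[LHS]mulr1 -crJ -counit_rightM mulVr ?cr1.
transitivity (contract23 σ (B' * tassoc (tmap Δ idfun (J * t * J^-1)) * B)).
  congr contract23; rewrite !rmorphM /= -/A -/A' !mulrA vj -!mulrA jv.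
  by rewrite !mulrA.
transitivity (contract12 σ (A' * tmap idfun Δ (J * t * J^-1) * A)); last first.
  congr contract12; rewrite !rmorphM /= -/B -/B' !mulrA jv -!mulrA vj.
  by rewrite !mulrA.
rewrite contract23_mulr // contract23_mull // contract12_mulr // contract12_mull //.
rewrite crJ crV clJ clV !mulr1 !mul1r.
move: (J * t * J^-1); apply: tens_ext => [||a b].
- by rewrite /contract23; lin.
- by rewrite /contract12; lin.
by rewrite contract23_comul contract12_comul σP.1.
Qed.

End Twist.

(** * Coseparable Hopf algebras are cosemisimple *)

Lemma memv_tens (k : fieldType) (U V : vectType k)
    (C : {vspace U}) (D : {vspace V}) c d :
  c \in C -> d \in D -> c ⊗ d \in tensv C D.
Proof.
move=> cC dD; rewrite {1}(coord_vbasis cC).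
rewrite (@lin_sum _ _ _ (fun z => z ⊗ d)); last by lin.
apply: memv_suml => i _; apply: memvZ.
rewrite {1}(coord_vbasis dD).
rewrite (@lin_sum _ _ _ (fun z => (vbasis C)`_i ⊗ z)); last by lin.
apply: memv_suml => j _; apply: memvZ.
by apply: memv_span; apply: allpairs_f; apply: mem_nth; rewrite size_tuple.
Qed.

Lemma linear_tensv (k : fieldType) (U V : vectType k) (W : vectType k)
    (C : {vspace U}) (D : {vspace V}) (f : tensor U V -> W) (E : {vspace W}) t :
  lin f -> (forall c d, c \in C -> d \in D -> f (c ⊗ d) \in E) ->
  t \in tensv C D -> f t \in E.
Proof.
move=> lf fE.
pose F : {linear tensor U V -> W} := HB.pack f (GRing.isLinear.Build _ _ _ _ f lf).
suff sub : (tensv C D <= linfun F @^-1: E)%VS.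
  by move=> /(subvP sub); rewrite -memv_preim lfunE.
apply/span_subvP => _ /allpairsP[[c d] /= [cC dD ->]].
by rewrite -memv_preim (lfunE F) /=; apply: fE; apply: vbasis_mem.
Qed.

Lemma eq_on_tensv (k : fieldType) (U V W : vectType k)
    (C : {vspace U}) (D : {vspace V}) (f g : tensor U V -> W) t :
  lin f -> lin g -> (forall c d, c \in C -> d \in D -> f (c ⊗ d) = g (c ⊗ d)) ->
  t \in tensv C D -> f t = g t.
Proof.
move=> lf lg fg tCD; apply/eqP; rewrite -subr_eq0 -memv0.
apply: (linear_tensv (f := fun t => f t - g t)) tCD => [|c d cC dD].
  by move=> u y z; rewrite lf lg scalerBr opprD addrACA.
by rewrite fg // subrr memv0.
Qed.

Section Averaging.
Variables (k : fieldType) (H : falgType k) (hH : hopfAlgebra H).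
Local Notation Δ := (comul hH).
Local Notation ε := (counit hH).
Variable σ : {linear tensor H H -> k^o}.
Hypothesis σP : coseparability hH σ.

Definition colinearl (g : H -> H) := forall x,
  Δ (g x) = tlift (fun a b => a ⊗ g b) (Δ x).
Definition colinearr (g : H -> H) := forall x,
  Δ (g x) = tlift (fun a b => g a ⊗ b) (Δ x).

(** These average g over σ as a module map is averaged over a separability
    idempotent, for the left and for the right coaction of H on itself. *)
Definition avgl (g : H -> H) (x : H) : H :=
  tlift (fun a b => tlift (fun c d => σ (a ⊗ c) *: d) (Δ (g b))) (Δ x).
Definition avgr (g : H -> H) (x : H) : H :=
  tlift (fun a b => tlift (fun c d => σ (d ⊗ b) *: c) (Δ (g a))) (Δ x).

(** The first axiom of the form exchanges x_1 σ(x_2 ⊗ y) with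
    σ(x ⊗ y_1) y_2, which moves the free component of Δ(g(x)) to x. *)
Lemma avgl_colinear g : lin g -> colinearl (avgl g).
Proof.
move=> lg x; rewrite /avgl comp_tlift; last by lin.
have lΔg (F : H -> H -> tensor H H) : lin (fun b => tlift F (Δ (g b))) by lin.
transitivity (tlift (fun a b => tlift (fun c d =>
     tlift (fun c1 c2 => σ (a ⊗ c1) *: (c2 ⊗ d)) (Δ c)) (Δ (g b))) (Δ x)).
  apply: eq_tlift => a b; rewrite comp_tlift; last by lin.
  rewrite (coassoc3 hH (F := fun c1 c2 d => σ (a ⊗ c1) *: (c2 ⊗ d))); try lin.
  apply: eq_tlift => c d; rewrite linearZ /= {1}(comul_tens hH).
  rewrite (@comp_tlift _ _ _ _ _ (fun z : tensor H H => (σ (a ⊗ c) : k) *: z)) //.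
  exact/lin_scaler/lin_id.
transitivity (tlift (fun a b => tlift (fun c d =>
     tlift (fun a1 a2 => σ (a2 ⊗ c) *: (a1 ⊗ d)) (Δ a)) (Δ (g b))) (Δ x)).
  apply: eq_tlift => a b; apply: eq_tlift => c d.
  transitivity (tlift (fun c1 c2 => σ (a ⊗ c1) *: c2) (Δ c) ⊗ d).
    rewrite (@comp_tlift _ _ _ _ _ (fun z : H => z ⊗ d)); last by lin.
    apply: eq_tlift => c1 c2.
    rewrite (@lin_scale _ _ _ (fun z : H => z ⊗ d)) //; lin.
  rewrite -σP.1 (@comp_tlift _ _ _ _ _ (fun z : H => z ⊗ d)); last by lin.
  apply: eq_tlift => c1 c2.
  rewrite (@lin_scale _ _ _ (fun z : H => z ⊗ d)) //; lin.
transitivity (tlift (fun a b => tlift (fun a1 a2 => tlift (fun c d =>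
      σ (a2 ⊗ c) *: (a1 ⊗ d)) (Δ (g b))) (Δ a)) (Δ x)).
  by apply: eq_tlift => a b; rewrite tlift_exchange.
rewrite (coassoc3 hH (F := fun a1 a2 b => tlift (fun c d =>
      σ (a2 ⊗ c) *: (a1 ⊗ d)) (Δ (g b)))); try lin.
apply: eq_tlift => a b.
rewrite (@comp_tlift _ _ _ _ _ (fun z : H => a ⊗ z)); last by lin.
apply: eq_tlift => b1 b2.
rewrite (@comp_tlift _ _ _ _ _ (fun z : H => a ⊗ z)); last by lin.
apply: eq_tlift => c d.
rewrite (@lin_scale _ _ _ (fun z : H => a ⊗ z)) //; lin.
Qed.

Lemma avgr_colinear g : lin g -> colinearr (avgr g).
Proof.
move=> lg x; rewrite /avgr comp_tlift; last by lin.
transitivity (tlift (fun a b => tlift (fun c d =>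
     tlift (fun d1 d2 => σ (d2 ⊗ b) *: (c ⊗ d1)) (Δ d)) (Δ (g a))) (Δ x)).
  apply: eq_tlift => a b; rewrite comp_tlift; last by lin.
  rewrite -(coassoc3 hH (F := fun c d1 d2 => σ (d2 ⊗ b) *: (c ⊗ d1))); try lin.
  apply: eq_tlift => c d; rewrite linearZ /= {1}(comul_tens hH).
  rewrite (@comp_tlift _ _ _ _ _ (fun z : tensor H H => (σ (d ⊗ b) : k) *: z)) //.
  exact/lin_scaler/lin_id.
transitivity (tlift (fun a b => tlift (fun c d =>
     tlift (fun b1 b2 => σ (d ⊗ b1) *: (c ⊗ b2)) (Δ b)) (Δ (g a))) (Δ x)).
  apply: eq_tlift => a b; apply: eq_tlift => c d.
  transitivity (c ⊗ tlift (fun d1 d2 => σ (d2 ⊗ b) *: d1) (Δ d)).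
    rewrite (@comp_tlift _ _ _ _ _ (fun z : H => c ⊗ z)); last by lin.
    apply: eq_tlift => d1 d2.
    rewrite (@lin_scale _ _ _ (fun z : H => c ⊗ z)) //; lin.
  rewrite σP.1 (@comp_tlift _ _ _ _ _ (fun z : H => c ⊗ z)); last by lin.
  apply: eq_tlift => b1 b2.
  rewrite (@lin_scale _ _ _ (fun z : H => c ⊗ z)) //; lin.
transitivity (tlift (fun a b => tlift (fun b1 b2 => tlift (fun c d =>
      σ (d ⊗ b1) *: (c ⊗ b2)) (Δ (g a))) (Δ b)) (Δ x)).
  by apply: eq_tlift => a b; rewrite tlift_exchange.
rewrite -(coassoc3 hH (F := fun a b1 b2 => tlift (fun c d =>
      σ (d ⊗ b1) *: (c ⊗ b2)) (Δ (g a)))); try lin.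
apply: eq_tlift => a b.
rewrite (@comp_tlift _ _ _ _ _ (fun z : H => z ⊗ b)); last by lin.
apply: eq_tlift => a1 a2.
rewrite (@comp_tlift _ _ _ _ _ (fun z : H => z ⊗ b)); last by lin.
apply: eq_tlift => c d.
rewrite (@lin_scale _ _ _ (fun z : H => z ⊗ b)) //; lin.
Qed.

(** The right average only involves components to the right of the first one,
    so that the two averages can be taken in succession. *)
Lemma avgr_colinearl g : lin g -> colinearl g -> colinearl (avgr g).
Proof.
move=> lg cg x; rewrite /avgr comp_tlift; last by lin.
transitivity (tlift (fun a b => tlift (fun a1 a2 => tlift (fun c d =>
    σ (d ⊗ b) *: (a1 ⊗ c)) (Δ (g a2))) (Δ a)) (Δ x)).
  apply: eq_tlift => a b; rewrite comp_tlift; last by lin.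
  transitivity (tlift (fun c d =>
      tlift (fun d1 d2 => σ (d2 ⊗ b) *: (c ⊗ d1)) (Δ d)) (Δ (g a))).
    rewrite -(coassoc3 hH (F := fun c d1 d2 => σ (d2 ⊗ b) *: (c ⊗ d1))); try lin.
    apply: eq_tlift => c d; rewrite linearZ /= {1}(comul_tens hH).
    rewrite (@comp_tlift _ _ _ _ _ (fun z : tensor H H => (σ (d ⊗ b) : k) *: z)) //.
    exact/lin_scaler/lin_id.
  rewrite cg (@comp_tlift _ _ _ _ _
    (tlift (fun c d => tlift (fun d1 d2 => σ (d2 ⊗ b) *: (c ⊗ d1)) (Δ d))));
    last exact: linearP.
  by apply: eq_tlift => a1 a2; rewrite tliftE //; lin.
rewrite (coassoc3 hH (F := fun a1 a2 b => tlift (fun c d =>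
    σ (d ⊗ b) *: (a1 ⊗ c)) (Δ (g a2)))); try lin.
apply: eq_tlift => a b.
rewrite (@comp_tlift _ _ _ _ _ (fun z : H => a ⊗ z)); last by lin.
apply: eq_tlift => b1 b2.
rewrite (@comp_tlift _ _ _ _ _ (fun z : H => a ⊗ z)); last by lin.
apply: eq_tlift => c d.
rewrite (@lin_scale _ _ _ (fun z : H => a ⊗ z)) //; lin.
Qed.

Lemma memv_tlift (F : H -> H -> H) t (D : {vspace H}) :
  (forall a b, F a b \in D) -> tlift F t \in D.
Proof.
by move=> FD; apply: memv_suml => i _; apply: memv_suml => j _; apply: memvZ.
Qed.

Variable D : {vspace H}.
Hypothesis sD : subcoalgebra hH D.

Lemma avgl_in g : (forall x, g x \in D) -> forall x, avgl g x \in D.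
Proof.
move=> gD x; apply: memv_tlift => a b.
apply: linear_tensv (sD (gD b)) => [|c d _ dD]; first exact: linearP.
by rewrite tliftE; [apply: memvZ|lin|lin].
Qed.

Lemma avgr_in g : (forall x, g x \in D) -> forall x, avgr g x \in D.
Proof.
move=> gD x; apply: memv_tlift => a b.
apply: linear_tensv (sD (gD a)) => [|c d cD _]; first exact: linearP.
by rewrite tliftE; [apply: memvZ|lin|lin].
Qed.

Lemma avgl_id g :
  lin g -> {in D, forall x, g x = x} -> {in D, forall x, avgl g x = x}.
Proof.
move=> lg gid x xD.
transitivity (tlift (fun a b => tlift (fun c d => σ (a ⊗ c) *: d) (Δ b)) (Δ x)).
  apply: (eq_on_tensv _ _ _ (sD xD)) => [||a b aD bD]; try exact: linearP.
  by rewrite !tliftE; try lin; rewrite gid.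
rewrite -(coassoc3 hH (F := fun a c d => σ (a ⊗ c) *: d)); try lin.
rewrite -[RHS](counitl hH); apply: eq_tlift => a b.
rewrite -σP.2 {2}(comul_tens hH) (comp_tlift (L := σ)); last exact: linearP.
rewrite (@comp_tlift _ _ _ _ _ (fun z : k^o => z *: b)) //.
by move=> u y z; rewrite scalerDl scalerA.
Qed.

Lemma avgr_id g :
  lin g -> {in D, forall x, g x = x} -> {in D, forall x, avgr g x = x}.
Proof.
move=> lg gid x xD.
transitivity (tlift (fun a b => tlift (fun c d => σ (d ⊗ b) *: c) (Δ a)) (Δ x)).
  apply: (eq_on_tensv _ _ _ (sD xD)) => [||a b aD bD]; try exact: linearP.
  by rewrite !tliftE; try lin; rewrite gid.
rewrite (coassoc3 hH (F := fun c d b => σ (d ⊗ b) *: c)); try lin.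
rewrite -[RHS](counitr hH); apply: eq_tlift => a b.
rewrite -σP.2 {2}(comul_tens hH) (comp_tlift (L := σ)); last exact: linearP.
rewrite (@comp_tlift _ _ _ _ _ (fun z : k^o => z *: a)) //.
by move=> u y z; rewrite scalerDl scalerA.
Qed.

Lemma subcoalgebra_projection : exists P : {linear H -> H},
  [/\ forall x, P x \in D, {in D, forall x, P x = x}, colinearl P & colinearr P].
Proof.
have l0 : lin (projv D) by exact: linearP.
have l1 : lin (avgl (projv D)) by rewrite /avgl; lin.
have l2 : lin (avgr (avgl (projv D))) by rewrite /avgr; lin.
pose P : {linear H -> H} :=
  HB.pack (avgr (avgl (projv D))) (GRing.isLinear.Build _ _ _ _ _ l2).
exists P; split; rewrite /P /=.
- by apply/avgr_in/avgl_in => x; apply: memv_proj.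
- by apply: avgr_id => //; apply: avgl_id => // x; apply: projv_id.
- by apply: avgr_colinearl => //; apply: avgl_colinear.
- exact: avgr_colinear.
Qed.

(** The map q = id - P vanishes on D and is idempotent and colinear on both
    sides, hence Δ(q(x)) = Δ(q(q(x))) = q(x_1) ⊗ q(x_2): the image of a
    subcoalgebra under q is a subcoalgebra. *)
Lemma subcoalgebra_complement (E : {vspace H}) :
  subcoalgebra hH E -> (D <= E)%VS -> exists D' : {vspace H},
  [/\ subcoalgebra hH D', (D :&: D' = 0)%VS & (D + D' = E)%VS].
Proof.
move=> sE DE; have [P [PD Pid Pl Pr]] := subcoalgebra_projection.
have [q qE] : exists q : {linear H -> H}, forall x, q x = x - P x.
  by exists (idfun \- P).
have PP x : P (P x) = P x by apply: Pid.
have Pq x : P (q x) = 0 by rewrite qE linearB /= PP subrr.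
have qq x : q (q x) = q x by rewrite {1}qE Pq subr0.
have tB (F G : H -> H -> tensor H H) t :
    tlift (fun a b => F a b - G a b) t = tlift F t - tlift G t.
  rewrite /tlift -sumrB; apply: eq_bigr => i _; rewrite -sumrB.
  by apply: eq_bigr => j _; rewrite scalerBr.
have ql : colinearl q.
  move=> x; rewrite qE linearB /= Pl {1}(comul_tens hH) -tB; apply: eq_tlift => a b.
  by rewrite qE; apply/matrixP=> i j; rewrite !mxE linearB mulrBr.
have qr : colinearr q.
  move=> x; rewrite qE linearB /= Pr {1}(comul_tens hH) -tB; apply: eq_tlift => a b.
  by rewrite qE; apply/matrixP=> i j; rewrite !mxE linearB mulrBl.
exists (linfun q @: E)%VS; split.
- move=> _ /memv_imgP[x xE ->]; rewrite lfunE /= -qq.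
  have -> : Δ (q (q x)) = tlift (fun a b => q a ⊗ q b) (Δ x).
    rewrite ql qr.
    rewrite (@comp_tlift _ _ _ _ _ (tlift (fun a b => a ⊗ q b))); last exact: linearP.
    by apply: eq_tlift => a b; rewrite tliftE //; lin.
  apply: linear_tensv (sE x xE) => [|a b aE bE]; first exact: linearP.
  rewrite tliftE; try lin.
  by apply: memv_tens; apply/memv_imgP; [exists a|exists b]; rewrite ?lfunE.
- apply/eqP; rewrite -subv0; apply/subvP=> x; rewrite memv_cap => /andP[xD].
  case/memv_imgP=> y yE; rewrite lfunE /= => xq.
  by rewrite memv0 -(Pid x xD) xq Pq.
- apply/eqP; rewrite eqEsubv subv_add DE /=; apply/andP; split.
    apply/subvP=> _ /memv_imgP[x xE ->]; rewrite lfunE /= qE memvB //.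
    by apply: (subvP DE).
  apply/subvP=> x xE; rewrite -[x](subrK (P x)) addrC memv_add //.
  by apply/memv_imgP; exists x => //; rewrite lfunE.
Qed.

End Averaging.

Section Decomposition.
Variables (k : fieldType) (H : falgType k) (hH : hopfAlgebra H).
Local Notation Δ := (comul hH).
Local Notation ε := (counit hH).

(** Induction on the dimension: E is zero, or simple, or splits as the sum of
    two proper subcoalgebras. A list of summands makes concatenation easy, and
    directness is recorded as additivity of the dimension. *)
Lemma coseparable_decomposition (σ : {linear tensor H H -> k^o}) n (E : {vspace H}) :
  coseparability hH σ -> subcoalgebra hH E -> (\dim E <= n)%N ->
  exists Cs : seq {vspace H}, [/\ forall C, C \in Cs -> simple_subcoalgebra hH C,
    (\sum_(C <- Cs) C)%VS = E & (\sum_(C <- Cs) \dim C)%N = \dim E].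
Proof.
move=> σP; elim: n E => [|n IHn] E sE.
  rewrite leqn0 dimv_eq0 => /eqP->; exists [::].
  by split=> //; rewrite big_nil ?dimv0.
move=> dE; have [->|E0] := eqVneq E 0%VS.
  by exists [::]; split=> //; rewrite big_nil ?dimv0.
have [[D [sD DE D0 DnE]]|nD] := classic (exists D : {vspace H},
    [/\ subcoalgebra hH D, (D <= E)%VS, D <> 0%VS & D <> E]); last first.
  exists [:: E]; rewrite !big_seq1; split=> // C; rewrite inE => /eqP->.
  split=> // D sD DE; have [->|D0] := eqVneq D 0%VS; first by left.
  have [->|DnE] := eqVneq D E; first by right.
  by case: nD; exists D; split=> //; apply/eqP.
have [D' [sD' DD' EDD']] := subcoalgebra_complement σP sD sE DE.
have dDD' : (\dim D + \dim D')%N = \dim E by rewrite -EDD' dimv_disjoint_sum.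
have D_gt0 : (0 < \dim D)%N by rewrite lt0n dimv_eq0; apply/eqP.
have D'_gt0 : (0 < \dim D')%N.
  rewrite lt0n dimv_eq0; apply: contra_notN DnE => /eqP D'0.
  by rewrite -EDD' D'0 addv0.
have [|Cs [sCs sumCs dimCs]] := IHn D sD.
  by rewrite -ltnS (leq_trans _ dE) // -dDD' -addn1 leq_add2l.
have [|Cs' [sCs' sumCs' dimCs']] := IHn D' sD'.
  by rewrite -ltnS (leq_trans _ dE) // -dDD' -add1n leq_add2r.
exists (Cs ++ Cs'); rewrite !big_cat /= sumCs sumCs' dimCs dimCs'; split=> //.
by move=> C; rewrite mem_cat => /orP[/sCs|/sCs'].
Qed.

Lemma coseparable_cosemisimple (σ : {linear tensor H H -> k^o}) :
  coseparability hH σ -> cosemisimple hH.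
Proof.
move=> σP; have sH : subcoalgebra hH {:H}.
  move=> c _; rewrite -[comul hH c]tlift_tens; apply: memv_suml => i _.
  by apply: memv_suml => j _; apply/memvZ/memv_tens; apply: memvf.
have [Cs [sCs sumCs dimCs]] := coseparable_decomposition σP sH (leqnn _).
have sum_eq : (\sum_(i < size Cs) nth 0 Cs i)%VS = {:H}%VS.
  by rewrite -sumCs (big_nth 0%VS) big_mkord.
exists (size Cs), (fun i => nth 0%VS Cs i); split=> [i||].
- by apply/sCs/mem_nth.
- by rewrite directvE /= sum_eq -dimCs (big_nth 0%VS) big_mkord.
exact: sum_eq.
Qed.

(** * The integral attached to the trivial subcoalgebra *)

(** The projection p onto a summand of a decomposition into subcoalgebras is
    colinear on both sides: p(x) = ε(p(x_1)) x_2 = x_1 ε(p(x_2)). So 1, being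
    grouplike, is sent to a multiple of itself, which is nonzero for one of the
    summands. That summand contains 1, so by simplicity it is k1, and the
    identities for p say that ε ∘ p is a two-sided integral. *)
Lemma cosemisimple_integral : cosemisimple hH ->
  exists λ : {linear H -> k^o},
  [/\ forall x, tlift (fun a b => λ b *: a) (comul hH x) = λ x *: 1,
      forall x, tlift (fun a b => λ a *: b) (comul hH x) = λ x *: 1 & λ 1 = 1].
Proof.
case=> n [C [simC dirC sumC]].
pose p (i : 'I_n) : H -> H := sumv_pi (\sum_i C i)%VS i.
have lp i : lin (p i) by exact: linearP.
have pC i x : p i x \in C i by exact: memv_sum_pi.
have psum x : \sum_i p i x = x by apply: sumv_pi_sum; rewrite sumC memvf.
have pid i j x : x \in C j -> p i x = if i == j then x else 0.
  move=> xC; move/directv_sum_unique: dirC => /(_ (fun i => p i x)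
    (fun i => if i == j then x else 0)) dirC.
  have : \sum_i p i x == \sum_i (if i == j then x else 0).
    by rewrite psum -big_mkcond big_pred1_eq.
  rewrite dirC => [/forallP/(_ i)/eqP|//|{}i _] //.
  by case: eqP => [->|_]; rewrite ?mem0v.
have sum_in (W : vectType k) (f g : H -> W) : lin f -> lin g ->
    (forall j x, x \in C j -> f x = g x) -> f =1 g.
  move=> lf lg fg x; rewrite -(psum x).
  have ls (h : H -> W) : lin h -> h (\sum_i p i x) = \sum_i h (p i x).
    move=> lh; pose h' : {linear H -> W} :=
      HB.pack h (GRing.isLinear.Build _ _ _ _ h lh).
    by rewrite -[h]/(h' : _ -> _) linear_sum.
  by rewrite !ls //; apply: eq_bigr => i _; apply: fg (pC i x).
have pl i x : tlift (fun a b => ε (p i a) *: b) (Δ x) = p i x.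
  move: x; apply: sum_in => [||j x xC]; [lin|by []|].
  transitivity (if i == j then x else 0); last by rewrite (pid i j).
  have [sC _ _] := simC j.
  transitivity (tlift (fun a b => if i == j then ε a *: b else 0) (Δ x)).
    apply: (eq_on_tensv _ _ _ (sC x xC)) => [||a b aC bC]; try exact: linearP.
    rewrite !tliftE; try lin;
      try by case: (i == j) => *; [lin|move=> u y z; rewrite scaler0 addr0].
    by rewrite (pid i j) //; case: (i == j) => //; rewrite linear0 scale0r.
  case: (i == j); first exact: counitl.
  by rewrite /tlift big1 // => a _; rewrite big1 // => b _; rewrite scaler0.
have pr i x : tlift (fun a b => ε (p i b) *: a) (Δ x) = p i x.
  move: x; apply: sum_in => [||j x xC]; [lin|by []|].
  transitivity (if i == j then x else 0); last by rewrite (pid i j).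
  have [sC _ _] := simC j.
  transitivity (tlift (fun a b => if i == j then ε b *: a else 0) (Δ x)).
    apply: (eq_on_tensv _ _ _ (sC x xC)) => [||a b aC bC]; try exact: linearP.
    rewrite !tliftE; try lin;
      try by case: (i == j) => *; [lin|move=> u y z; rewrite scaler0 addr0].
    by rewrite (pid i j) //; case: (i == j) => //; rewrite linear0 scale0r.
  case: (i == j); first exact: counitr.
  by rewrite /tlift big1 // => a _; rewrite big1 // => b _; rewrite scaler0.
have p1 i : p i 1 = ε (p i 1) *: 1.
  by rewrite -{1}pl rmorph1 -tens1 tliftE //; lin.
have [i i0] : exists i, ε (p i 1) != 0.
  apply/existsP; apply: contra_neqT (oner_neq0 H); rewrite negb_exists.
  move=> /forallP p0.
  rewrite -(psum 1) big1 // => i _; rewrite p1.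
  by have /negPn/eqP-> := p0 i; rewrite scale0r.
have C1 : 1 \in C i.
  have := pC i 1; rewrite p1; move: (ε (p i 1)) i0 => c c0 cC.
  by rewrite -[1 : H](scalerK (c0 : (c : k) != 0)) memvZ.
have [_ _ simCi] := simC i.
have Ci : <[1 : H]>%VS = C i.
  have [||/eqP|//] := simCi <[1 : H]>%VS;
    last by rewrite -dimv_eq0 dim_vline oner_eq0.
    move=> _ /vlineP[c ->]; rewrite linearZ /= rmorph1 -tens1.
    by apply/memvZ/memv_tens; apply: memv_line.
  by rewrite -memvE.
have pE x : p i x = ε (p i x) *: 1.
  have := pC i x; rewrite -Ci => /vlineP[c ->].
  by rewrite linearZ /= rmorph1; congr (_ *: _); rewrite [RHS]mulr1.
have ll : linear (fun x => ε (p i x) : k^o).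
  by change (lin (fun x => ε (p i x) : k^o)); lin.
exists (HB.pack_for {linear H -> k^o} (fun x => ε (p i x) : k^o)
  (GRing.isLinear.Build _ _ _ _ _ ll)); split=> /=.
- by move=> x; rewrite pr.
- by move=> x; rewrite pl.
by rewrite (pid i i) // eqxx rmorph1.
Qed.

End Decomposition.

Theorem corollary3p6 (k : closedFieldType) (H : falgType k)
    (hH : hopfAlgebra H) (J : tensor H H) (hJ : is_twist hH J) :
  cosemisimple hH -> unimodular hH ->
  cosemisimple (twisted hJ) /\ unimodular (twisted hJ).
Proof.
move=> csH uniH; split; last exact: uniH.
have [λ [λ_left λ_right λ1]] := cosemisimple_integral csH.
apply: coseparable_cosemisimple (coseparability_twist hJ _ _ _).
- exact: integral_form_coseparability λ_left λ1.
- exact: integral_form_mull λ_left λ_right λ1 uniH.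
- exact: integral_form_mulr.
Qed.
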